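(* Let $\phi\in(0,\pi/2)$ and let $n=2k$ be even, with $k\ge 1$ an integer. A function $g\in C^\infty(\mathbb{R}^{2k-1}\times\mathbb{R})$ is in the range of $\mathcal{C}_\phi$ acting on $C_0^\infty(\mathbb{R}^n)$ (i.e. $g=\mathcal{C}_\phi[f]$ for some $f\in C_0^\infty(\mathbb{R}^n)$) if and only if the following conditions are satisfied: (i) $\square_\phi^k g(\boldsymbol{x},t)$ has compact support. (ii) $\int_{-\infty}^{\infty}\square_\phi^k g(\boldsymbol{x},t)\,dt=0$ for every $\boldsymbol{x}\in\mathbb{R}^{2k-1}$. (iii) $\operatorname{supp} g\subseteq H_{t_0}$ for some $t_0\in\mathbb{R}$.
   Context: Points of $\mathbb{R}^n=\mathbb{R}^{n-1}\times\mathbb{R}$ are written $(\boldsymbol{x},t)$. $C_0^\infty$ denotes smooth functions with compact support. For $t_0\in\mathbb{R}$, $H_{t_0}=\{(\boldsymbol{x},t): t\le t_0\}$. The modified d'Alembertian is $\square_\phi=\frac{\partial^2}{\partial t^2}-(\tan^2\phi)\,\Delta_{\boldsymbol{x}}$, where $\Delta_{\boldsymbol{x}}$ is the Laplacian in $\boldsymbol{x}\in\mathbb{R}^{n-1}$. The restricted conical Radon transform $\mathcal{C}_\phi$ (half-opening angle $\phi$, axis direction $\boldsymbol{e}_n=(\boldsymbol{0},1)$) is convolution with $D_\phi(\boldsymbol{x},t)=\delta(-t-|(\cot\phi)\boldsymbol{x}|)$, $\delta$ the Dirac delta, that is $$\mathcal{C}_\phi[f](\boldsymbol{x},t)=\int_{\mathbb{R}^{n-1}}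 f(\boldsymbol{x}+\boldsymbol{u},\,t+(\cot\phi)|\boldsymbol{u}|)\,d\boldsymbol{u}.$$ Up to a positive constant factor depending only on $\phi$ this is the integral of $f$ with respect to surface measure over the cone with vertex $(\boldsymbol{x},t)$, axis direction $\boldsymbol{e}_n$ and half-opening angle $\phi$. *)

(* Defs.v *)
From HB Require Import structures.
From mathcomp Require Import all_boot all_order all_algebra.
From mathcomp Require Import all_classical all_reals all_analysis.

Set Implicit Arguments.
Unset Strict Implicit.
Unset Printing Implicit Defensive.

Import Order.TTheory GRing.Theory Num.Theory.
Import numFieldNormedType.Exports.

Local Open Scope classical_set_scope.
Local Open Scope ring_scope.

Section LebesgueMeasureTuple.
Context {R : realType}.
Local Notation T m := (m.-tuple (measurableTypeR R)).

Definition tuple_cons (m : nat) (p : measurableTypeR R * T m) : T m.+1 :=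
  [tuple of p.1 :: p.2].

Definition tuple_uncons (m : nat) (u : T m.+1) : measurableTypeR R * T m :=
  (thead u, [tuple of behead u]).

Lemma tuple_consK (m : nat) : cancel (@tuple_cons m) (@tuple_uncons m).
Proof. by case=> x u; congr pair; exact: val_inj. Qed.

Lemma measurable_tuple_cons (m : nat) :
  measurable_fun [set: measurableTypeR R * T m] (@tuple_cons m).
Proof. exact: measurable_cons. Qed.

Lemma measurable_tuple_uncons (m : nat) :
  measurable_fun [set: T m.+1] (@tuple_uncons m).
Proof.
apply: measurable_fun_pair; last exact: measurable_behead.
exact: (@measurable_tnth _ (measurableTypeR R) m.+1 ord0).
Qed.

HB.instance Definition _ (m : nat) :=
  isMeasurableFun.Build _ _ _ _ (@tuple_cons m) (@measurable_tuple_cons m).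

Section LebesgueCons.
Local Open Scope ereal_scope.
Context (m : nat) (mu : {sigma_finite_measure set (T m) -> \bar R}).

Definition lebesgue_cons : set (T m.+1) -> \bar R :=
  pushforward (@lebesgue_measure R \x mu) (@tuple_cons m).

Let lebesgue_cons0 : lebesgue_cons set0 = 0.
Proof. exact: measure0. Qed.

Let lebesgue_cons_ge0 A : 0 <= lebesgue_cons A.
Proof. exact: measure_ge0. Qed.

Let lebesgue_cons_sigma_additive : semi_sigma_additive lebesgue_cons.
Proof. exact: measure_semi_sigma_additive. Qed.

HB.instance Definition _ := isMeasure.Build _ _ _ lebesgue_cons
  lebesgue_cons0 lebesgue_cons_ge0 lebesgue_cons_sigma_additive.

Let lebesgue_cons_sigma_finite : sigma_finite setT lebesgue_cons.
Proof.
have /sigma_finiteP[F [TF ndF Foo]] := sigma_finiteT (@lebesgue_measure R).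
have /sigma_finiteP[G [TG ndG Goo]] := sigma_finiteT mu.
exists (fun n => @tuple_uncons m @^-1` (F n `*` G n)).
  apply/seteqP; split=> // u _.
  have [i _ Fi] : (\bigcup_n F n) (tuple_uncons u).1 by rewrite -TF.
  have [j _ Gj] : (\bigcup_n G n) (tuple_uncons u).2 by rewrite -TG.
  exists (maxn i j) => //; split.
    by move: Fi; exact/subsetPset/ndF/leq_maxl.
  by move: Gj; exact/subsetPset/ndG/leq_maxr.
move=> n; have [mF Fnoo] := Foo n; have [mG Gnoo] := Goo n; split.
  rewrite -[X in measurable X]setTI; apply: measurable_tuple_uncons => //.
  exact: measurableX.
rewrite /lebesgue_cons /pushforward -comp_preimage.
rewrite (_ : _ \o _ = id) ?preimage_id; last exact/funext/tuple_consK.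
by rewrite product_measure1E// lte_mul_pinfty// ge0_fin_numE.
Qed.

HB.instance Definition _ := Measure_isSigmaFinite.Build _ _ _ lebesgue_cons
  lebesgue_cons_sigma_finite.

End LebesgueCons.

(* Lebesgue measure on R^m, carried by m-tuples because row vectors have no
   measurable structure in the library. *)
Fixpoint lebesgue_measure_tuple (m : nat) :
    {sigma_finite_measure set (T m) -> \bar R} :=
  match m with
  | 0 => dirac [tuple]
  | m'.+1 => lebesgue_cons (lebesgue_measure_tuple m')
  end.

Lemma lebesgue_measure_tuple_box (m : nat)
    (A : 'I_m -> set (measurableTypeR R)) :
  (forall i, measurable (A i)) ->
  lebesgue_measure_tuple m [set u : T m | forall i, A i (tnth u i)] =
  (\prod_(i < m) lebesgue_measure (A i))%E.
Proof.
elim: m A => [|m IH] A mA /=.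
  by rewrite big_ord0 diracE mem_set// => -[].
rewrite big_ord_recl -IH// -product_measure1E//.
  rewrite /lebesgue_cons /pushforward; congr (_ _ _).
  apply/seteqP; split=> -[x u] /=.
    move=> Au; split; first exact: (Au ord0).
    move=> i; have := Au (lift ord0 i).
    by rewrite tnthS; congr (A _ (tnth _ _)); exact: val_inj.
  move=> [Ax Au] i; have [j ->|->] := unliftP ord0 i; last exact: Ax.
  by rewrite tnthS; have := Au j; congr (A _ (tnth _ _)); exact: val_inj.
rewrite (_ : [set _ | _] = \bigcap_(i in [set: 'I_m])
  ((fun u : T m => tnth u i) @^-1` A (lift ord0 i))).
  apply: fin_bigcap_measurable => // i _.
  by rewrite -[X in measurable X]setTI; exact: measurable_tnth.
by apply/seteqP; split=> u /= Au i; [move=> _; exact: Au|exact: (Au i)].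
Qed.

End LebesgueMeasureTuple.

Section SpaceTime.
Context {R : realType} {m : nat}.
Local Notation V := ('rV[R]_m * R)%type.

(* Direction of the i-th spatial axis for [Some i], of the time axis for
   [None]. *)
Definition axis (i : option 'I_m) : V :=
  if i is Some j then (delta_mx 0 j, 0) else (0, 1).

Definition partial (i : option 'I_m) (f : V -> R) : V -> R := 'D_(axis i) f.

Definition smooth (f : V -> R) : Prop :=
  forall s : seq (option 'I_m),
    continuous (foldr partial f s) /\
    forall i p, derivable (foldr partial f s) p (axis i).

Definition supp (f : V -> R) : set V := closure [set p | f p != 0].

Definition laplacian_space (f : V -> R) (p : V) : R :=
  \sum_(i < m) partial (Some i) (partial (Some i) f) p.

Definition dalembertian (phi : R) (f : V -> R) (p : V) : R :=
  partial None (partial None f) p - tan phi ^+ 2 * laplacian_space f p.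

(* The library norm on ['rV[R]_m] is the sup norm. *)
Definition enorm (u : 'rV[R]_m) : R := Num.sqrt (\sum_(i < m) u 0 i ^+ 2).

Definition cot (phi : R) : R := cos phi / sin phi.

Definition conical_radon (phi : R) (f : V -> R) (p : V) : R :=
  \int[lebesgue_measure_tuple m]_u
    let v := \row_(i < m) tnth u i in
    f (p.1 + v, p.2 + cot phi * enorm v).

Definition half_space (t0 : R) : set V := [set p | p.2 <= t0].

End SpaceTime.

(* Main.v *)
Require Import Defs.
From mathcomp Require Import all_boot all_order all_algebra.
From mathcomp Require Import all_classical all_reals all_analysis.
From mathcomp Require Import measurable_realfun.
From mathcomp Require Import ring lra zify.

Set Implicit Arguments.
Unset Strict Implicit.
Unset Printing Implicit Defensive.

Import Order.TTheory GRing.Theory Num.Theory.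
Import numFieldNormedType.Exports.

Local Open Scope classical_set_scope.
Local Open Scope ring_scope.

(* Put m = 2k - 1, c = tan phi, and let V[h](r, tau) be the integral of
   h(x + c r z, t + tau) over the unit ball |z| < 1 of R^m, for a fixed point
   (x, t). The divergence theorem on the ball shows that V carries the
   d'Alembertian to the radial wave operator
   E_k = d^2/dtau^2 - d^2/dr^2 - (2k / r) d/dr.
   The operator L_k v = r v_r + (2k - 1) v satisfies E_(k-1) L_k = L_k E_k, and
   for v vanishing at late times an integration along the diagonal tau = r
   gives
     int r^(2k-1) (E_k v)(r, r) dr = (2k - 2) int r^(2k-3) (L_k v)(r, r) dr
   for k >= 2, while for k = 1 the left-hand side is v(0, 0). By iteration,
     int r^m V[box^k h](r, r) dr = m! |B| h(x, t)
   whenever h vanishes at late times. On the other hand, writing a function as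
   the integral of its time derivative over the future and exchanging the order
   of integration,
     C F(x, t) = - c^m int r^m V[dF/dt](r, r) dr.
   Hence, with N = c^m m! |B|:
   - box^k C f = C box^k f = - N df/dt, whose time integral vanishes;
   - if box^k g = h is compactly supported with vanishing time integrals, then
     F(x, t) = int_0^oo h(x, t + s) ds is compactly supported, dF/dt = - h, and
     C F = N g. *)

(** * Directional derivatives and smooth functions *)

(** [E_k] is the wave operator on radial functions in dimension 2k + 1. Averaging over balls instead
    of spheres raises the dimension from m = 2k - 1 to m + 2, but it uses Lebesgue measure alone.
    Each [L_k] then descends by two dimensions. The descent stops in dimension 3, where [r v]
    satisfies the wave equation on a line and the integral along the characteristic [tau = r] is a
    boundary value. That it stops exactly there is where the parity of [n] enters.

    No uniqueness theorem for [box^k] is used in the converse: the integral identity is applied to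
    [g] itself. Condition (iii) supplies the vanishing at late times that the identity requires of
    [g], and condition (ii) makes the primitive [F] vanish at early times.

    Smoothness is given by continuous iterated partial derivatives along the axes. Derivatives in
    other directions and the symmetry of mixed derivatives are therefore derived from the mean value
    theorem on lines. *)

Lemma is_derive_unique {R : realType} {V W : normedModType R} (f : V -> W)
  (p v : V) l l' : is_derive p v f l -> is_derive p v f l' -> l = l'.
Proof. by move=> [_ <-] [_ <-]. Qed.

Lemma ball_dist {R : numFieldType} {V : normedModType R} (x y : V) (e : R) :
  `|x - y| < e -> ball x e y.
Proof. by rewrite -ball_normE. Qed.

Lemma is_derive_derivable {R : realType} {V W : normedModType R} (f : V -> W)
  (p v : V) l : is_derive p v f l -> derivable f p v.
Proof. by case. Qed.

Lemma is_deriveP {R : realType} {V : normedModType R} (f : V -> R) (p v : V) (l : R) :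
  is_derive p v f l <->
  h^-1 *: (f (h *: v + p) - f p) @[h --> (0 : R)^'] --> l.
Proof.
split=> [[df <-]|cf]; first exact: df.
split; first by apply/cvg_ex; exists l.
exact/cvg_lim.
Qed.

Section DirectionalDerivative.
Context {R : realType} {V : normedModType R}.
Implicit Types (f g : V -> R) (p v w : V).

(** A directional derivative is a one-variable derivative along a line; through this equivalence the
    chain rule and the mean value theorem on the real line become available on any normed space. *)
Lemma is_derive_line f p v (a l : R) :
  is_derive (p + a *: v) v f l <-> is_derive a 1 (fun s => f (p + s *: v)) l.
Proof.
have E (h : R) : h^-1 *: (f (h *: v + (p + a *: v)) - f (p + a *: v)) =
    h^-1 *: (f (p + (h *: (1 : R) + a) *: v) - f (p + a *: v)).
  congr (_ *: (f _ - _)).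
  by rewrite scalerDl [_ *: 1]mulr1 addrCA.
split=> /is_deriveP fl; apply/is_deriveP; apply: cvg_trans fl; apply: near_eq_cvg.
  by apply: nearW => h; rewrite E.
by apply: nearW => h; rewrite E.
Qed.

Lemma is_derive_translate f p v w (l : R) :
  is_derive (p + w) v f l -> is_derive p v (fun q => f (q + w)) l.
Proof.
move=> /is_deriveP fl; apply/is_deriveP; apply: cvg_trans fl.
by apply: near_eq_cvg; apply: nearW => h; rewrite addrA.
Qed.

Lemma is_deriveZv f p v (b l : R) :
  is_derive p v f l -> is_derive p (b *: v) f (b * l).
Proof.
move=> df.
have /is_derive_line df0 : is_derive (p + 0 *: v) v f l by rewrite scale0r addr0.
suff : is_derive (p + 0 *: (b *: v)) (b *: v) f (b * l).
  by rewrite scale0r addr0.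
apply/is_derive_line.
have -> : (fun s : R => f (p + s *: (b *: v))) =
    (fun s => f (p + s *: v)) \o (fun s => s * b).
  by apply/funext => s /=; rewrite scalerA.
rewrite mulrC; apply: is_derive1_comp; first by rewrite mul0r.
apply: is_derive_eq; rewrite ?scaler0 ?add0r ?addr0 /GRing.scale /= ?mulr1//.
Qed.

Lemma is_derive_increment f p v (df : R -> R) :
  (forall s, is_derive (p + s *: v) v f (df s)) ->
  exists2 c, c \in `[0, 1] & f (p + v) - f p = df c.
Proof.
move=> fd.
have fd' (s : R) : is_derive s 1 (fun s => f (p + s *: v)) (df s).
  exact/is_derive_line.
have [|c c01] := @MVT_segment R _ df 0 1 ler01 (fun x _ => fd' x).
  by apply: derivable_within_continuous => x _; exact: is_derive_derivable (fd' x).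
by rewrite scale1r scale0r addr0 subr0 mulr1 => fE; exists c.
Qed.

(* Differentiability along [v] at the point and a continuous derivative along
   [w] suffice, so that Frechet differentiability is not needed. *)
Lemma is_deriveDv f p v w (lv : R) (fw : V -> R) :
  is_derive p v f lv -> (forall q, is_derive q w f (fw q)) ->
  {for p, continuous fw} ->
  is_derive p (v + w) f (lv + fw p).
Proof.
move=> /is_deriveP fv dfw cfw; apply/is_deriveP.
have fE h : h^-1 *: (f (h *: (v + w) + p) - f p) =
    h^-1 *: (f (h *: v + p) - f p) +
    h^-1 *: (f ((h *: v + p) + h *: w) - f (h *: v + p)).
  rewrite -scalerDr; congr (_ *: _); rewrite [RHS]addrC subrKA.
  by rewrite scalerDr addrAC.
under eq_fun do rewrite fE.
apply: cvgD => //.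
apply/cvgrPdist_lt => e e0.
have /cvgrPdist_lt/(_ _ e0)/nbhs_ballP[d /= d0 fwd] := cfw.
rewrite near_withinE; near=> h => h0.
have [c c01 ->] := @is_derive_increment f (h *: v + p) (h *: w)
  (fun s => h * fw (h *: v + p + s *: (h *: w)))
  (fun s => is_deriveZv h (dfw _)).
rewrite [_^-1 *: _]mulKf//; apply: fwd; apply: ball_dist.
rewrite (addrC (h *: v)) -addrA opprD addrA subrr add0r normrN.
rewrite scalerA mulrC -scalerA -scalerDr normrZ.
(* The intermediate point lies within [|h| (|v| + |w|)] of [p]; the extra 1 keeps the divisor
   positive when both directions vanish. *)
have : `|h| * (`|v| + `|w| + 1) < d.
  rewrite -ltr_pdivlMr ?ltr_wpDl ?addr_ge0//.
  near: h; apply: (@nbhs0_lt _ R).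
  by rewrite divr_gt0 ?ltr_wpDl ?addr_ge0.
apply: le_lt_trans; rewrite ler_wpM2l// (le_trans (ler_normD _ _))//.
rewrite -addrA lerD// normrZ.
move: c01; rewrite in_itv /= => /andP[c0 c1].
by rewrite ger0_norm// ler_wpDr// ler_piMl.
Unshelve. all: by end_near. Qed.

Lemma is_derive_sumv (I : Type) (s : seq I) f p (v : I -> V) (c : I -> R)
    (df : I -> V -> R) :
  (forall i q, is_derive q (v i) f (df i q)) -> (forall i, continuous (df i)) ->
  is_derive p (\sum_(i <- s) c i *: v i) f (\sum_(i <- s) c i * df i p).
Proof.
move=> dfE cdf; elim: s => [|i s IH]; first by rewrite !big_nil; exact: is_derive0.
rewrite !big_cons addrC (addrC (c i * _)).
have cdfi : {for p, continuous (fun q => c i * df i q)}.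
  by apply: cvgM; [exact: cvg_cst|exact: cdf].
exact: (is_deriveDv IH (fun q => is_deriveZv (c i) (dfE i q)) cdfi).
Qed.

End DirectionalDerivative.

Lemma partialE {R : realType} {m : nat} i (f : 'rV[R]_m * R -> R) p :
  partial i f p = 'D_(axis i) f p.
Proof. by []. Qed.

Lemma smoothP {R : realType} {m : nat} (f : 'rV[R]_m * R -> R) :
  smooth f <-> forall s, continuous (foldr partial f s) /\
    forall i p, derivable (foldr partial f s) p (axis i).
Proof. by []. Qed.

(** Recast as a sum of two functions, so that additivity and homogeneity of [partial] and [smooth]
    apply. *)
Lemma dalembertianE {R : realType} {m : nat} phi (f : 'rV[R]_m * R -> R) :
  dalembertian phi f = partial None (partial None f) \+
    (fun p => (- tan phi ^+ 2) *
      \sum_(i < m) partial (Some i) (partial (Some i) f) p).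
Proof. by apply/funext => p /=; rewrite mulNr. Qed.

(* Unification must not unfold iterated derivatives down to limits. *)
Opaque partial smooth dalembertian.

Section Smooth.
Context {R : realType} {m : nat}.
Local Notation V := ('rV[R]_m * R)%type.
Implicit Types (f g : V -> R) (p v : V) (i j : option 'I_m).

Definition acoord (v : V) (i : option 'I_m) : R :=
  if i is Some j then v.1 0 j else v.2.

Definition dirD (v : V) (f : V -> R) (p : V) : R :=
  \sum_i acoord v i * partial i f p.

Lemma big_optionE (F : option 'I_m -> R) :
  \sum_i F i = F None + \sum_(j < m) F (Some j).
Proof.
rewrite (bigID (fun i : option 'I_m => i == None)) /= big_pred1_eq; congr (_ + _).
rewrite (reindex_omap Some id) /=; last by case.
by apply: eq_bigl => i; rewrite /= eqxx.
Qed.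

Lemma sum_acoord (v : V) : v = \sum_i acoord v i *: axis i.
Proof.
have E2 : v.2 = (\sum_i acoord v i *: axis i).2.
  rewrite (raddf_sum (@snd _ _)) big_optionE/= big1 ?addr0; last first.
    by move=> i _; rewrite [LHS]mulr0.
  by rewrite [RHS]mulr1.
have E1 : v.1 = (\sum_i acoord v i *: axis i).1.
  apply/rowP => j; rewrite (raddf_sum (@fst _ _)) summxE big_optionE/= !mxE.
  rewrite mulr0 add0r (bigD1 j) //= !mxE !eqxx mulr1 big1 ?addr0//.
  by move=> i ij; rewrite !mxE eqxx (eq_sym j) (negbTE ij) mulr0.
by rewrite [LHS]surjective_pairing E1 E2 -surjective_pairing.
Qed.

Lemma smooth_partial i f : smooth f -> smooth (partial i f).
Proof. by move=> /smoothP sf; apply/smoothP => s; rewrite -foldr_rcons; exact: sf. Qed.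

Lemma smooth_continuous f : smooth f -> continuous f.
Proof. by move=> /smoothP/(_ [::])[]. Qed.

Lemma is_derive_axis f i p : smooth f -> is_derive p (axis i) f (partial i f p).
Proof. by move=> /smoothP/(_ [::])[_ df]; rewrite partialE; apply/derivableP. Qed.

(** Since the partial derivatives are continuous, the axes can be added one at a time by
    [is_derive_sumv]. *)
Lemma is_derive_dirD f p v : smooth f -> is_derive p v f (dirD v f p).
Proof.
move=> sf; rewrite {1}(sum_acoord v).
apply: (@is_derive_sumv _ _ _ _ f p axis (acoord v) (fun i => partial i f)).
- by move=> i q; exact: is_derive_axis.
- by move=> i; apply: smooth_continuous; exact: smooth_partial.
Qed.

Lemma partialD f g i : smooth f -> smooth g ->
  partial i (f \+ g) = partial i f \+ partial i g.
Proof.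
move=> sf sg; apply/funext => p.
by rewrite /= !partialE deriveD//; apply: is_derive_derivable; exact: is_derive_axis.
Qed.

Lemma partialZ f (a : R) i : smooth f ->
  partial i (fun p => a * f p) = (fun p => a * partial i f p).
Proof.
move=> sf; apply/funext => p.
rewrite !partialE -[RHS]/(a *: _) -deriveZ//.
by apply: is_derive_derivable; exact: is_derive_axis.
Qed.

Lemma foldr_partialD f g s : smooth f -> smooth g ->
  foldr partial (f \+ g) s = foldr partial f s \+ foldr partial g s.
Proof.
(* The last entry of [s] is the innermost derivative; removing it leaves smooth functions, to which
   the induction hypothesis applies. *)
elim/last_ind: s f g => [//|s i IH] f g sf sg.
rewrite 3!foldr_rcons (partialD i sf sg).
exact: (IH _ _ (smooth_partial i sf) (smooth_partial i sg)).
Qed.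

Lemma foldr_partialZ f (a : R) s : smooth f ->
  foldr partial (fun p => a * f p) s = (fun p => a * foldr partial f s p).
Proof.
elim/last_ind: s f => [//|s i IH] f sf.
rewrite 2!foldr_rcons (partialZ a i sf).
exact: (IH _ (smooth_partial i sf)).
Qed.

Lemma smoothD f g : smooth f -> smooth g -> smooth (f \+ g).
Proof.
move=> sf sg; apply/smoothP => s; rewrite foldr_partialD//.
have [cf df] := (smoothP f).1 sf s; have [cg dg] := (smoothP g).1 sg s.
split; first by move=> p; apply: cvgD; [exact: cf|exact: cg].
by move=> i p; apply: derivableD; [exact: df|exact: dg].
Qed.

Lemma smoothZ f (a : R) : smooth f -> smooth (fun p => a * f p).
Proof.
move=> sf; apply/smoothP => s; rewrite foldr_partialZ//.
have [cf df] := (smoothP f).1 sf s; split.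
  by move=> p; apply: cvgM; [exact: cvg_cst|exact: cf].
by move=> i p; apply: (@derivableZ _ _ _ _ a); exact: df.
Qed.

Lemma smooth0 : smooth (fun _ : V => 0 : R).
Proof.
apply/smoothP => s; suff -> : foldr partial (fun=> 0 : R) s = (fun=> 0 : R) :> (V -> R).
  by split; [move=> p; exact: cvg_cst|move=> i p; exact: derivable_cst].
elim/last_ind: s => [//|s i IH]; rewrite foldr_rcons -[RHS]IH; congr foldr.
by apply/funext => p; rewrite partialE; exact: derive_cst.
Qed.

Lemma smooth_sum (I : Type) (s : seq I) (F : I -> V -> R) :
  (forall k, smooth (F k)) -> smooth (fun p => \sum_(i <- s) F i p).
Proof.
move=> sF; elim: s => [|i s IH].
  by under eq_fun do rewrite big_nil; exact: smooth0.
under eq_fun do rewrite big_cons.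
exact: (smoothD (sF i) IH).
Qed.

Lemma partial_sum (I : Type) (s : seq I) (F : I -> V -> R) j :
  (forall k, smooth (F k)) ->
  partial j (fun p => \sum_(i <- s) F i p) =
  (fun p => \sum_(i <- s) partial j (F i) p).
Proof.
move=> sF; elim: s => [|i s IH].
  under eq_fun do rewrite big_nil; apply/funext => p; rewrite big_nil.
  rewrite partialE; exact: derive_cst.
under eq_fun do rewrite big_cons.
rewrite (@partialD (F i) (fun p => \sum_(i <- s) F i p))//; last exact: smooth_sum.
by rewrite IH; apply/funext => p; rewrite big_cons.
Qed.

(** Both mixed derivatives are limits of the same second difference of [f], which is symmetric in
    the two axes. *)
Lemma partialC f i j : smooth f ->
  partial i (partial j f) = partial j (partial i f).
Proof.
move=> sf; apply/funext => p; apply/eqP; rewrite -subr_eq0 -normr_eq0.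
apply/eqP/le_anti; rewrite normr_ge0 andbT; apply/ler_addgt0Pr => e e0.
rewrite add0r.
have key k l (e' : R) : 0 < e' -> \forall h \near (0 : R)^',
    `|partial l (partial k f) p -
      h^-1 * (h^-1 * (f (p + h *: axis k + h *: axis l) - f (p + h *: axis k) -
                      (f (p + h *: axis l) - f p)))| < e'.
  move=> e'0.
  have /cvgrPdist_lt/(_ _ e'0)/nbhs_ballP[d /= d0 cd] :
    {for p, continuous (partial l (partial k f))}.
    by apply: smooth_continuous; do 2 apply: smooth_partial.
  rewrite near_withinE; near=> h => h0.
  (* Two mean value theorems: one for the increment [G] along [axis k], then one for [partial k f]
     along [axis l]. *)
  pose G q := f (q + h *: axis l) - f q.
  have dG s : is_derive (p + s *: (h *: axis k)) (h *: axis k) G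
      (h * (partial k f (p + s *: (h *: axis k) + h *: axis l) -
            partial k f (p + s *: (h *: axis k)))).
    apply: is_deriveZv; apply: is_deriveB; last exact: is_derive_axis.
    exact/is_derive_translate/is_derive_axis.
  have [c c01 GE] := is_derive_increment dG.
  have -> : f (p + h *: axis k + h *: axis l) - f (p + h *: axis k) -
     (f (p + h *: axis l) - f p) = G (p + h *: axis k) - G p by [].
  rewrite GE mulKf//.
  have [c' c'01 ->] := @is_derive_increment _ _ (partial k f)
    (p + c *: (h *: axis k)) (h *: axis l)
    (fun s => h * partial l (partial k f) (p + c *: (h *: axis k) + s *: (h *: axis l)))
    (fun s => is_deriveZv h (is_derive_axis _ _ (smooth_partial k sf))).
  rewrite mulKf//; apply: cd; apply: ball_dist.
  rewrite -addrA opprD addrA subrr add0r normrN.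
  have : `|h| * (`|axis k : V| + `|axis l : V| + 1) < d.
    rewrite -ltr_pdivlMr ?ltr_wpDl ?addr_ge0//.
    near: h; apply: (@nbhs0_lt _ R).
    by rewrite divr_gt0 ?ltr_wpDl ?addr_ge0.
  apply: le_lt_trans; rewrite (le_trans (ler_normD _ _))// !normrZ -addrA.
  rewrite mulrDr lerD//.
    move: c01; rewrite in_itv /= => /andP[c0 c1].
    by rewrite ger0_norm// ler_piMl// mulr_ge0.
  rewrite mulrDr mulr1 ler_wpDr//.
  move: c'01; rewrite in_itv /= => /andP[c0 c1].
  by rewrite ger0_norm// ler_piMl// mulr_ge0.
have e20 : 0 < e / 2 by rewrite divr_gt0.
near (0 : R)^' => h.
rewrite (splitr e).
rewrite (le_trans (ler_distD (h^-1 * (h^-1 *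
  (f (p + h *: axis j + h *: axis i) - f (p + h *: axis j) -
  (f (p + h *: axis i) - f p)))) _ _))// lerD// ltW//.
  by near: h; exact: key.
have -> : f (p + h *: axis j + h *: axis i) - f (p + h *: axis j) -
    (f (p + h *: axis i) - f p) =
  f (p + h *: axis i + h *: axis j) - f (p + h *: axis i) -
    (f (p + h *: axis j) - f p).
  rewrite (addrAC p (h *: axis j)).
  by move: (f (_ + _ + _)) (f (_ + _)) (f (_ + _)) (f p) => x1 x2 x3 x4; ring.
rewrite distrC; near: h; exact: key.
Unshelve. all: by end_near. Qed.

Lemma smooth_laplacian_space f :
  smooth f -> smooth (fun p => \sum_(i < m) partial (Some i) (partial (Some i) f) p).
Proof. by move=> sf; apply: smooth_sum => i; do 2 apply: smooth_partial. Qed.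

Lemma smooth_dalembertian (phi : R) f : smooth f -> smooth (dalembertian phi f).
Proof.
move=> sf; rewrite dalembertianE; apply: smoothD.
  by do 2 apply: smooth_partial.
exact/smoothZ/smooth_laplacian_space.
Qed.

Lemma smooth_iter_dalembertian (phi : R) f n :
  smooth f -> smooth (iter n (dalembertian phi) f).
Proof.
move=> sf; elim: n => [|n IH]; first exact: sf.
by rewrite iterS; exact: smooth_dalembertian.
Qed.

Lemma partial_swap2 f i j : smooth f ->
  partial i (partial j (partial j f)) = partial j (partial j (partial i f)).
Proof.
move=> sf; transitivity (partial j (partial i (partial j f))).
  exact: (partialC i j (smooth_partial j sf)).
exact: (congr1 (partial j) (partialC i j sf)).
Qed.

Lemma partial_laplacian_space f i : smooth f ->
  partial i (fun p => \sum_(j < m) partial (Some j) (partial (Some j) f) p) =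
  (fun p => \sum_(j < m) partial (Some j) (partial (Some j) (partial i f)) p).
Proof.
move=> sf; rewrite partial_sum; last by move=> j; do 2 apply: smooth_partial.
apply/funext => p; apply: eq_bigr => j _.
exact: (congr1 (fun F => F p) (partial_swap2 i (Some j) sf)).
Qed.

Lemma partial_dalembertian (phi : R) f i : smooth f ->
  partial i (dalembertian phi f) = dalembertian phi (partial i f).
Proof.
move=> sf; rewrite !dalembertianE.
have sL := smooth_laplacian_space sf.
have s2 : smooth (partial None (partial None f)) by do 2 apply: smooth_partial.
rewrite (partialD i s2 (smoothZ _ sL)) (partialZ _ i sL).
exact: (congr2 (fun A B => A \+ (fun p => - tan phi ^+ 2 * B p))
  (partial_swap2 i None sf) (partial_laplacian_space i sf)).
Qed.

Lemma partial_iter_dalembertian (phi : R) f i n : smooth f ->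
  partial i (iter n (dalembertian phi) f) = iter n (dalembertian phi) (partial i f).
Proof.
move=> sf; elim: n => [|n IH]; first by [].
exact: (etrans (partial_dalembertian phi i (smooth_iter_dalembertian phi n sf))
  (congr1 (dalembertian phi) IH)).
Qed.

End Smooth.

(** * Measurability of continuous functions on space-time *)

Section Measurability.
Context {R : realType} {m : nat}.
Local Notation V := ('rV[R]_m * R)%type.

Lemma norm_acoord_lt (v : V) (e : R) :
  0 < e -> (forall i, `|acoord v i| < e) -> `|v| < e.
Proof.
move=> e0 ve; have : ball (0 : V) e v.
  split; last by apply: ball_dist; rewrite sub0r normrN; exact: (ve None).
  split => //.
  by move=> i j /=; apply: ball_dist; rewrite mxE sub0r normrN ord1; exact: (ve (Some j)).
by rewrite -ball_normE /= sub0r normrN.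
Qed.

Lemma acoord_norm_le (v : V) i : `|acoord v i| <= `|v|.
Proof.
rewrite leNgt; apply/negP => vi.
have : ball (0 : V) `|acoord v i| v by apply: ball_dist; rewrite sub0r normrN.
case: i vi => [j|] vi [] /=.
  by move=> [_ /(_ 0 j)] + _; rewrite -ball_normE /= mxE sub0r normrN ltxx.
by move=> _; rewrite -ball_normE /= sub0r normrN ltxx.
Qed.

(* The coordinates are rounded down to multiples of [1 / n.+1]: [F \o q] is a
   pointwise limit of functions with countably many values. *)
Lemma measurable_continuous_comp d (X : measurableType d) (q : X -> V)
    (F : V -> R) :
  continuous F -> (forall i, measurable_fun [set: X] (fun x => acoord (q x) i)) ->
  measurable_fun [set: X] (F \o q).
Proof.
move=> cF mq.
pose cell (n : nat) x : {ffun option 'I_m -> int} :=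
  [ffun i => Num.floor (acoord (q x) i * n.+1%:R)].
pose pt (n : nat) (j : {ffun option 'I_m -> int}) : V :=
  (\row_k ((j (Some k))%:~R / n.+1%:R), (j None)%:~R / n.+1%:R).
have coord_pt n j i : acoord (pt n j) i = (j i)%:~R / n.+1%:R.
  by case: i => [k|] //=; rewrite mxE.
apply: (@measurable_fun_cvg _ _ _ _ (fun n x => F (pt n (cell n x)))).
- move=> n _ Y mY; rewrite setTI.
  rewrite (_ : _ @^-1` _ = \bigcup_j
      [set x | cell n x = j /\ Y (F (pt n j))]); last first.
    by apply/seteqP; split=> x /=; [exists (cell n x)|move=> [j _ [<-]]].
  apply: countable_bigcupT_measurable => [|j]; first exact: countableP.
  have [Yj|nYj] := pselect (Y (F (pt n j))); last first.
    by rewrite (_ : [set _ | _] = set0)//; apply/seteqP; split => x //= -[].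
  rewrite (_ : [set _ | _] = \bigcap_(i in [set: option 'I_m])
     [set x | acoord (q x) i * n.+1%:R \in `[(j i)%:~R, (j i + 1)%:~R[]); last first.
    apply/seteqP; split=> x /=.
      by move=> [<- _] i _ /=; rewrite ffunE in_itv /=; exact: floor_itv.
    move=> xj; split => //; apply/ffunP => i; rewrite ffunE.
    by apply: floor_def; have := xj i Logic.I; rewrite /= in_itv.
  apply: fin_bigcap_measurable => // i _.
  rewrite -[X in measurable X]setTI.
  have mqn := measurable_funM (mq i) (@measurable_cst _ _ _ _ setT (n.+1%:R : R)).
  exact: (mqn measurableT _ (measurable_itv `[(j i)%:~R, (j i + 1)%:~R[)).
- move=> x _.
  have : pt n (cell n x) @[n --> \oo] --> q x.
    apply/cvgrPdist_lt => e e0; near=> n.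
    apply: norm_acoord_lt => // i.
    have -> : acoord (q x - pt n (cell n x)) i = acoord (q x) i - acoord (pt n (cell n x)) i.
      by case: i => [k|]//=; rewrite !mxE.
    rewrite coord_pt ffunE.
    set c := acoord _ _.
    have n0 : 0 < n.+1%:R :> R by [].
    have -> : c - (Num.floor (c * n.+1%:R))%:~R / n.+1%:R =
        (c * n.+1%:R - (Num.floor (c * n.+1%:R))%:~R) / n.+1%:R.
      by rewrite mulrBl mulfK// gt_eqF.
    have /andP[f1 f2] := floor_itv (c * n.+1%:R).
    rewrite normrM normfV ger0_norm ?subr_ge0// (ger0_norm (ltW n0)).
    rewrite ltr_pdivrMr//; apply: (@lt_le_trans _ _ 1).
      by rewrite ltrBlDl -[1]/(1%:~R) -intrD.
    rewrite mulrC -ler_pdivrMr//.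
    have : n.+1%:R^-1 < e by near: n; exact: near_infty_natSinv_lt (PosNum e0).
    by move=> ne; rewrite div1r invf_ple ?posrE// ?invr_gt0// ltW.
  by move=> /cvg_comp; apply; exact: cF.
Unshelve. all: by end_near. Qed.

End Measurability.

(** * Integration on row vectors *)

Section LebesgueScaling.
Context {R : realType}.
Local Notation lambda := (@lebesgue_measure R).
Local Open Scope ereal_scope.

(** By uniqueness of Lebesgue measure: [a] times its image under dilation by [a] gives every
    half-open interval its length. *)
Lemma lebesgue_measure_scale (a : R) (a0 : (0 < a)%R) (f : R -> \bar R) :
  measurable_fun [set: measurableTypeR R] f -> (forall x, 0 <= f x) ->
  \int[lambda]_x f x = a%:E * \int[lambda]_x f (a * x)%R.
Proof.
move=> mf f0.
have mphi : measurable_fun [set: measurableTypeR R]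
    ((fun x => (a * x)%R) : measurableTypeR R -> measurableTypeR R).
  exact: measurable_funM.
pose nu0 : {measure set (measurableTypeR R) -> \bar R} :=
  mscale (NngNum (ltW a0))
    (pushforward lambda (fun x : measurableTypeR R => (a * x)%R : measurableTypeR R)).
pose nu := nu0 mphi.
have lnu A : measurable A -> lambda A = nu A.
  apply: lebesgue_measure_unique => _ [[x y] /= _ <-].
  rewrite /nu /mscale /= /pushforward.
  rewrite (_ : _ @^-1` _ = `](x / a)%R, (y / a)%R]%classic); last first.
    apply/seteqP; split => z /=; rewrite !in_itv /= ltr_pdivrMr// ler_pdivlMr//.
      by rewrite (mulrC z).
    by rewrite (mulrC z).
  rewrite !lebesgue_measure_itv /= !lte_fin ltr_pM2r ?invr_gt0//.
  case: ifPn => _; last by rewrite mule0.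
  by rewrite -!EFinD -EFinM -mulrBl mulrC divfK// gt_eqF.
rewrite (eq_measure_integral nu); last by move=> A mA _; exact: lnu.
rewrite ge0_integral_mscale//.
congr (_ * _).
have := @ge0_integral_pushforward _ _ _ _ R _ mphi lambda setT f measurableT mf.
by rewrite preimage_setT; apply => x _; exact: f0.
Qed.

Lemma Rintegral_scale (a : R) (a0 : (0 < a)%R) (f : R -> R) :
  lambda.-integrable setT (EFin \o f) ->
  (\int[lambda]_x f x = a * \int[lambda]_x f (a * x))%R.
Proof.
move=> intf; have mf := measurable_int _ intf.
have mphi : measurable_fun [set: measurableTypeR R]
    ((fun x => (a * x)%R) : measurableTypeR R -> measurableTypeR R).
  exact: measurable_funM.
have Ep := @lebesgue_measure_scale a a0 ((EFin \o f)^\+)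
  (measurable_funepos mf) (fun=> funepos_ge0 _ _).
have En := @lebesgue_measure_scale a a0 ((EFin \o f)^\-)
  (measurable_funeneg mf) (fun=> funeneg_ge0 _ _).
have fp := integrable_pos_fin_num measurableT intf.
have fn := integrable_neg_fin_num measurableT intf.
(* Finiteness of the dilated parts is read off from that of the original ones after cancelling
   [a]. *)
have aE x : x = a^-1%:E * (a%:E * x).
  by rewrite muleA -EFinM mulVf ?gt_eqF// mul1e.
have fp' : \int[lambda]_x (EFin \o f)^\+ (a * x)%R \is a fin_num.
  by rewrite (aE (integral _ _ _)) -Ep fin_numM.
have fn' : \int[lambda]_x (EFin \o f)^\- (a * x)%R \is a fin_num.
  by rewrite (aE (integral _ _ _)) -En fin_numM.
transitivity (fine (a%:E * \int[lambda]_x (EFin \o f)^\+ (a * x)%R -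
                    a%:E * \int[lambda]_x (EFin \o f)^\- (a * x)%R)).
  congr fine; rewrite integralE.
  by congr (_ - _); [exact: Ep|exact: En].
rewrite fineB ?fin_numM// !fineM// -mulrBr; congr (_ * _)%R.
rewrite -fineB//; congr fine; apply/esym.
rewrite integralE; congr (_ - _); apply: eq_integral => x _.
  by rewrite !funeposE.
by rewrite !funenegE.
Qed.

End LebesgueScaling.

Section TupleIntegral.
Context {R : realType}.

Definition rowt {m : nat} (u : m.-tuple R) : 'rV[R]_m := \row_i tnth u i.

Definition Int {m : nat} (f : 'rV[R]_m -> R) : R :=
  \int[lebesgue_measure_tuple m]_u f (rowt u).

(** One constant serves as height and as half-width, so a single number witnesses both boundedness
    and bounded support. *)
Definition box {m : nat} (M : R) (z : 'rV[R]_m) : R :=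
  M * [forall i, `|z 0 i| <= M]%:R.

(** A class in which integrability and Fubini are automatic, stable under sums, multiples, slices
    and positive dilations. Measurability is stated through [rowt] because the measure lives on
    tuples. *)
Definition nice {m : nat} (f : 'rV[R]_m -> R) :=
  measurable_fun [set: m.-tuple (measurableTypeR R)] (f \o rowt) /\
  exists M, forall z, `|f z| <= box M z.

Section fixed_dimension.
Context {m : nat}.
Local Notation mu := (@lebesgue_measure_tuple R m).
Implicit Types f g : 'rV[R]_m -> R.

Lemma measurable_rowt_continuous f :
  continuous f -> measurable_fun [set: m.-tuple (measurableTypeR R)] (f \o rowt).
Proof.
move=> cf.
have cF : continuous (fun p : 'rV[R]_m * R => f p.1).
  by move=> p; apply: (@continuous_comp _ _ _ fst f); [exact: cvg_fst|exact: cf].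
apply: (measurable_continuous_comp (q := fun u => (rowt u, 0))) cF _.
case=> [j|] /=; last exact: measurable_cst.
under eq_fun do rewrite mxE; exact: measurable_tnth.
Qed.

Lemma box_le (M N : R) (z : 'rV[R]_m) : 0 <= N -> M <= N -> box M z <= box N z.
Proof.
move=> N0 MN; rewrite /box; case: (boolP [forall i, _]) => /= [/forallP zM|_].
  have -> : [forall i, `|z 0 i| <= N].
    by apply/forallP => i; exact: le_trans (zM i) MN.
  by rewrite !mulr1.
by rewrite mulr0 mulr_ge0.
Qed.

Lemma box_in (M : R) (z : 'rV[R]_m) : (forall i, `|z 0 i| <= M) -> box M z = M.
Proof. by move=> /forallP zM; rewrite /box zM mulr1. Qed.

Lemma measurable_tuple_box (M : R) : measurable
  [set u : m.-tuple (measurableTypeR R) | forall i, `[-M, M]%classic (tnth u i)].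
Proof.
set A := [set _ | _].
rewrite (_ : A = \bigcap_(i in [set: 'I_m]) ((fun u => tnth u i) @^-1` `[-M, M]%classic)).
  apply: fin_bigcap_measurable => // i _.
  rewrite -[X in measurable X]setTI.
  exact: (@measurable_tnth _ (measurableTypeR R) m i measurableT _ (measurable_itv `[-M, M])).
by apply/seteqP; split=> u /= Au i; [move=> _; exact: Au|exact: (Au i)].
Qed.

Lemma integrable_box (M : R) : mu.-integrable setT (EFin \o (box M \o rowt)).
Proof.
pose A := [set u : m.-tuple (measurableTypeR R) | forall i, `[-M, M]%classic (tnth u i)].
have mA : measurable A by exact: measurable_tuple_box.
have muA : (mu A < +oo)%E.
  have -> : mu A = (\prod_(i < m)
      lebesgue_measure (`[(-M)%R, M]%classic : set (measurableTypeR R)))%E.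
    exact: (@lebesgue_measure_tuple_box R m (fun=> `[-M, M]%classic)
      (fun=> measurable_itv `[-M, M])).
  rewrite (eq_bigr (fun=> (if - M < M then M + M else 0)%:E)).
    by rewrite prodEFin ltry.
  move=> i _; rewrite lebesgue_measure_itv /= lte_fin.
  by case: ifP => // _; rewrite -EFinD opprK.
have -> : EFin \o (box M \o rowt) = (fun u => M%:E * (\1_A u)%:E)%E.
  apply/funext => u; rewrite /= /box EFinM; congr (_ * _%:E)%E.
  rewrite indicE; congr (_%:R); congr nat_of_bool.
  apply/forallP/idP => [uM|]; rewrite ?inE.
    by move=> i; move: (uM i); rewrite mxE ler_norml /= in_itv.
  by move=> Au i; move: (Au i); rewrite mxE ler_norml /= in_itv.
apply: integrableZl => //.
apply/integrableP; split; first exact/measurable_EFinP/measurable_indic.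
under eq_integral do rewrite gee0_abs ?lee_fin//.
by rewrite integral_indic// setIT.
Qed.

Lemma nice_integrable f : nice f -> mu.-integrable setT (EFin \o (f \o rowt)).
Proof.
move=> [mf [M fM]]; apply: le_integrable (integrable_box M) => //.
  exact/measurable_EFinP.
move=> u _ /=; rewrite lee_fin (le_trans (fM _))//; exact: ler_norm.
Qed.

Lemma nice_bound f : nice f -> exists2 M, 0 <= M & forall z, `|f z| <= box M z.
Proof.
move=> [_ [M fM]]; exists (Num.max M 0); first by rewrite le_max lexx orbT.
move=> z; apply: le_trans (fM z) _.
by apply: box_le; rewrite le_max lexx ?orbT.
Qed.

(** Only the support grows, not the height; this lets bounds with different half-widths be added or
    rescaled. *)
Lemma box_widen (M N : R) (z : 'rV[R]_m) : 0 <= M -> M <= N ->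
  box M z <= M * [forall i, `|z 0 i| <= N]%:R.
Proof.
move=> M0 MN; rewrite ler_wpM2l// ler_nat.
case: (boolP [forall i, `|z 0 i| <= M]) => // /forallP zM.
by rewrite lt0b; apply/forallP => i; exact: le_trans (zM i) MN.
Qed.

Lemma boxD (M N : R) (z : 'rV[R]_m) : 0 <= M -> 0 <= N ->
  box M z + box N z <= box (M + N) z.
Proof.
by move=> M0 N0; rewrite {3}/box mulrDl lerD// box_widen// ?lerDl ?lerDr.
Qed.

Lemma niceD f g : nice f -> nice g -> nice (f \+ g).
Proof.
move=> nf ng; split; first exact: (measurable_funD nf.1 ng.1).
have [M M0 fM] := nice_bound nf; have [N N0 gN] := nice_bound ng.
exists (M + N) => z; rewrite (le_trans (ler_normD _ _))//.
by rewrite (le_trans (lerD (fM z) (gN z)))// boxD.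
Qed.

Lemma niceZ f (a : R) : nice f -> nice (fun z => a * f z).
Proof.
move=> nf; split; first exact: (measurable_funM (measurable_cst a) nf.1).
have [M M0 fM] := nice_bound nf.
have aM0 : 0 <= `|a| * M by rewrite mulr_ge0.
exists (M + `|a| * M) => z; rewrite normrM.
rewrite (le_trans (ler_wpM2l _ (fM z)))//.
rewrite (le_trans (ler_wpM2l _ (@box_widen M (M + `|a| * M) z M0 _)))// ?lerDl//.
by rewrite mulrA /box ler_wpM2r// lerDr.
Qed.

Lemma IntD f g : nice f -> nice g -> Int (f \+ g) = Int f + Int g.
Proof. by move=> nf ng; rewrite /Int RintegralD//; exact: nice_integrable. Qed.

Lemma IntZ f (a : R) : nice f -> Int (fun z => a * f z) = a * Int f.
Proof. by move=> nf; rewrite /Int RintegralZl//; exact: nice_integrable. Qed.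

Lemma Int0 : Int (fun _ : 'rV[R]_m => 0 : R) = 0.
Proof. by rewrite /Int /Rintegral integral0. Qed.

Lemma nice0 : nice (fun _ : 'rV[R]_m => 0 : R).
Proof.
split; first exact: measurable_cst.
by exists 0 => z; rewrite normr0 /box mul0r.
Qed.

Lemma nice_sum (I : Type) (s : seq I) (F : I -> 'rV[R]_m -> R) :
  (forall i, nice (F i)) -> nice (fun z => \sum_(i <- s) F i z).
Proof.
move=> nF; elim: s => [|i s IH].
  by under eq_fun do rewrite big_nil; exact: nice0.
by under eq_fun do rewrite big_cons; exact: niceD.
Qed.

Lemma Int_sum (I : Type) (s : seq I) (F : I -> 'rV[R]_m -> R) :
  (forall i, nice (F i)) ->
  Int (fun z => \sum_(i <- s) F i z) = \sum_(i <- s) Int (F i).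
Proof.
move=> nF; elim: s => [|i s IH].
  by under eq_fun do rewrite big_nil; rewrite big_nil Int0.
under eq_fun do rewrite big_cons.
by rewrite (IntD (nF i) (nice_sum s nF)) IH big_cons.
Qed.

End fixed_dimension.

Definition row_cons {m : nat} (x : R) (z : 'rV[R]_m) : 'rV[R]_m.+1 :=
  \row_i (if unlift ord0 i is Some j then z 0 j else x).

Lemma rowt_cons {m : nat} (x : R) (u : m.-tuple (measurableTypeR R)) :
  rowt (tuple_cons (x, u)) = row_cons x (rowt u).
Proof.
apply/rowP => i; rewrite !mxE; case: unliftP => [j ->|->]; last by [].
by rewrite tnthS mxE; congr tnth; exact: val_inj.
Qed.

Section cons.
Context {m : nat}.
Implicit Types f g : 'rV[R]_m.+1 -> R.

Lemma box_cons (M x : R) (z : 'rV[R]_m) : 0 <= M ->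
  box M (row_cons x z) = (`|x| <= M)%R%:R * box M z.
Proof.
move=> M0; rewrite /box mulrCA -natrM mulnb; congr (_ * (nat_of_bool _)%:R).
apply/forallP/andP => [zM|[xM /forallP zM] i].
  split; first by move: (zM ord0); rewrite mxE unlift_none.
  by apply/forallP => i; move: (zM (lift ord0 i)); rewrite mxE liftK.
by rewrite mxE; case: unliftP => [j _|_].
Qed.

Lemma nice_cons f (x : R) : nice f -> nice (fun z => f (row_cons x z)).
Proof.
move=> nf; split.
  have -> : (fun z : 'rV_m => f (row_cons x z)) \o rowt =
      (fun u => ((f \o rowt) \o @tuple_cons R m) (x, u)).
    by apply/funext => u /=; rewrite rowt_cons.
  apply: measurable_fun_pair2; apply: measurableT_comp; first exact: nf.1.
  exact: measurable_tuple_cons.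
have [M M0 fM] := nice_bound nf; exists M => z; rewrite (le_trans (fM _))//.
by rewrite box_cons// ler_piMl ?mulr_ge0// lern1 leq_b1.
Qed.

Local Notation lambda := (@lebesgue_measure R).
Local Notation mu := (@lebesgue_measure_tuple R m).

Lemma nice_comp_cons f : (fun p => (f (row_cons p.1 (rowt p.2)))%:E) =
  (EFin \o (f \o rowt)) \o @tuple_cons R m.
Proof. by apply/funext => -[x u] /=; rewrite rowt_cons. Qed.

Lemma nice_integrable_cons f : nice f ->
  (lambda \x mu)%E.-integrable setT (fun p => (f (row_cons p.1 (rowt p.2)))%:E).
Proof.
move=> nf; rewrite nice_comp_cons.
have /integrableP[mf foo] := nice_integrable nf.
apply/integrableP; split.
  by apply: measurableT_comp => //; exact: measurable_tuple_cons.
have := @ge0_integral_pushforward _ _ _ _ R _ (@measurable_tuple_cons R m)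
  (lambda \x mu)%E setT (fun u => `|(EFin \o (f \o rowt)) u|%E) measurableT.
rewrite preimage_setT => <- //.
exact: measurableT_comp.
Qed.

Lemma Int_prod f : nice f ->
  Int f = fine (\int[lambda \x mu]_p (f (row_cons p.1 (rowt p.2)))%:E)%E.
Proof.
move=> nf; rewrite /Int /Rintegral; congr fine.
have intf := nice_integrable_cons nf.
rewrite nice_comp_cons in intf *.
have /integrableP[mf _] := nice_integrable nf.
have := @integral_pushforward _ _ _ _ R _ (@measurable_tuple_cons R m)
  (lambda \x mu)%E setT (EFin \o (f \o rowt)) mf.
by rewrite preimage_setT; apply.
Qed.

Lemma Int_cons f : nice f ->
  Int f = \int[lambda]_x Int (fun z => f (row_cons x z)).
Proof.
move=> nf; rewrite Int_prod// /Rintegral; congr fine.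
rewrite -(integral12_prod_meas1 (nice_integrable_cons nf)).
apply: eq_integral => x _; rewrite /fubini_F /Int /Rintegral fineK//.
exact: (integrable_fin_num measurableT (nice_integrable (nice_cons x nf))).
Qed.

Lemma integrable_Int_cons f : nice f ->
  lambda.-integrable setT (EFin \o (fun x => Int (fun z => f (row_cons x z)))).
Proof.
move=> nf; have := integrable_fubini_F (nice_integrable_cons nf).
apply: eq_integrable => // x _; rewrite /fubini_F /Int /Rintegral /= fineK//.
exact: (integrable_fin_num measurableT (nice_integrable (nice_cons x nf))).
Qed.

Lemma integrable_row_cons f z : nice f ->
  lambda.-integrable setT (EFin \o (fun x => f (row_cons x (rowt z)))).
Proof.
move=> nf; have [M M0 fM] := nice_bound nf.
have intM := @integrable_indic_itv R (-M) M true false.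
have := integrableZl measurableT M intM.
apply: le_integrable => //.
  apply/measurable_EFinP.
  have -> : (fun x => f (row_cons x (rowt z))) =
      (fun x => ((f \o rowt) \o @tuple_cons R m) (x, z)).
    by apply/funext => x /=; rewrite rowt_cons.
  apply: measurable_fun_pair1; apply: measurableT_comp; first exact: nf.1.
  exact: measurable_tuple_cons.
move=> x _ /=; rewrite lee_fin (le_trans (fM _))// box_cons//.
rewrite normrM (ger0_norm M0) indicE.
have -> : (x \in `[- M, M]%classic) = (`|x| <= M).
  by apply/idP/idP; rewrite inE /= in_itv /= ler_norml.
by rewrite normr_nat mulrC ler_wpM2r// /box ler_piMr// lern1 leq_b1.
Qed.

(** The head coordinate is integrated innermost here and outermost in [Int_cons]; applying both to
    one function is the exchange of order behind [conical_radon_ball_mean]. *)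
Lemma Int_cons_swap f : nice f ->
  Int f = Int (fun z => \int[lambda]_x f (row_cons x z)).
Proof.
move=> nf; rewrite Int_prod// /Int /Rintegral; congr fine.
rewrite -(integral21_prod_meas1 (nice_integrable_cons nf)).
apply: eq_integral => z _; rewrite /fubini_G fineK//.
exact: (integrable_fin_num measurableT (integrable_row_cons z nf)).
Qed.

End cons.
End TupleIntegral.

(** * One-variable integrals and differentiation under the integral *)

Section OneVariable.
Context {R : realType}.
Local Notation lambda := (@lebesgue_measure R).

Lemma Rintegral_FTC2 (F f : R -> R) (a b : R) : a <= b ->
  (forall x : R, is_derive x 1 F (f x)) -> continuous f ->
  \int[lambda]_(x in `[a, b]) f x = F b - F a.
Proof.
rewrite le_eqVlt => /predU1P[<- _ _|ab dF cf].
  by rewrite set_itv1 Rintegral_set1 subrr.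
have cF : continuous F.
  move=> x; apply: differentiable_continuous; apply/derivable1_diffP.
  exact: is_derive_derivable (dF x).
rewrite /Rintegral (@continuous_FTC2 R f F a b) //.
- exact: continuous_subspaceT.
- split; first by move=> x _; exact: is_derive_derivable (dF x).
  + by apply: cvg_at_right_filter; exact: cF.
  + by apply: cvg_at_left_filter; exact: cF.
- by move=> x _; rewrite derive1E; case: (dF x).
Qed.

Lemma Rintegral_eq0_outside (g : R -> R) (A D : set R) : A `<=` D ->
  (forall x, D x -> ~ A x -> g x = 0) ->
  \int[lambda]_(x in D) g x = \int[lambda]_(x in A) g x.
Proof.
move=> AD g0; rewrite Rintegral_mkcond [RHS]Rintegral_mkcond; congr (Rintegral _ _).
apply/funext => x; rewrite /patch; case: ifPn; case: ifPn => //.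
  by rewrite notin_setE inE => Ax /g0; exact.
by rewrite inE notin_setE => /AD.
Qed.

Lemma Rintegral_setT_outside (g : R -> R) (D : set R) :
  (forall x, ~ D x -> g x = 0) ->
  \int[lambda]_x g x = \int[lambda]_(x in D) g x.
Proof. by move=> g0; apply: Rintegral_eq0_outside => // x _; exact: g0. Qed.

Lemma Rintegral_fun0 (D : set R) (g : R -> R) : (forall x, D x -> g x = 0) ->
  \int[lambda]_(x in D) g x = 0.
Proof.
move=> g0; rewrite /Rintegral integral0_eq// => x Dx.
by rewrite g0.
Qed.

Lemma is_derive_eq0_near (G : R -> R) (l x : R) :
  is_derive x 1 G l -> (\forall y \near x, G y = 0) -> l = 0.
Proof.
move=> [_ <-] G0.
have [_ //] : is_derive x 1 G 0.
have G0' : \forall y \near x, (cst 0 : R -> R) y = G y.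
  by apply: filterS G0 => y ->.
exact: (near_eq_is_derive G0' (is_derive_cst _ _ _)).
Qed.

Lemma Rintegral_derive0 (G g : R -> R) (M : R) :
  (forall x : R, is_derive x 1 G (g x)) -> continuous g ->
  (forall x, M < `|x| -> G x = 0) ->
  \int[lambda]_x g x = 0.
Proof.
(* [K] strictly exceeds [M], so [G] vanishes at both ends of [[-K, K]]; outside this interval [G] is
   locally zero and hence [g] vanishes. *)
move=> dG cg G0; pose K := `|M| + 1.
have MK : M < K by rewrite ltr_pwDr// ler_norm.
have K0 : 0 <= K by rewrite addr_ge0.
rewrite (@Rintegral_setT_outside _ `[-K, K]) => [|x /= xK].
  rewrite (Rintegral_FTC2 _ dG)//; last by rewrite ge0_cp.
  by rewrite !G0 ?subrr// ?normrN ger0_norm.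
have Kx : M < `|x|.
  rewrite ltNge; apply/negP => h; apply: xK; rewrite in_itv /= -ler_norml.
  by rewrite (le_trans h)// ltW.
apply: (is_derive_eq0_near (dG x)).
have : \forall y \near x, M < `|y|.
  have cn : `|y| @[y --> x] --> `|x| by apply: cvg_norm; exact: cvg_id.
  by have := cvgr_gt `|x| cn; apply.
by apply: filterS => y /G0.
Qed.

(** Domination is local in the parameter, because bounds obtained by compactness hold only for
    parameters in a bounded interval. *)
Lemma is_derive_Rintegral d (Y : measurableType d)
    (mu : {measure set Y -> \bar R}) (D : set Y) (f f' : R -> Y -> R) (G : Y -> R)
    (a e : R) :
  measurable D -> 0 < e ->
  (forall (x : R) y, `|x - a| < e -> is_derive x 1 (f ^~ y) (f' x y)) ->
  (forall x y, `|x - a| < e -> `|f' x y| <= G y) ->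
  mu.-integrable D (EFin \o G) ->
  (forall x, `|x - a| < e -> mu.-integrable D (EFin \o f x)) ->
  is_derive a 1 (fun x => \int[mu]_(y in D) f x y) (\int[mu]_(y in D) f' a y).
Proof.
move=> mD e0 df f'G iG fi.
have I x : `]a - e, a + e[%classic x -> `|x - a| < e.
  by rewrite /= in_itv /= ltr_distl.
have Ia : `]a - e, a + e[%classic a.
  by rewrite /= in_itv /= ltrBlDr !ltrDl e0.
have d1 x y : `]a - e, a + e[%classic x -> partial1of2 f x y = f' x y.
  by move=> /I xa; rewrite partial1of2E; case: (df x y xa).
have G0 y : 0 <= G y by exact: le_trans (f'G _ y (I _ Ia)).
have := @cvg_differentiation_under_integral R _ Y mu f D mD a (a - e) (a + e)
  Ia (fun x Ix => fi x (I x Ix))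
  (fun x y Ix _ => is_derive_derivable (df x y (I x Ix))) G G0 iG.
have h x y : `]a - e, a + e[%classic x -> D y -> `|partial1of2 f x y| <= G y.
  by move=> Ix _; rewrite d1//; exact/f'G/I.
move=> /(_ h) {h} cF; apply/is_deriveP.
have <- : \int[mu]_(y in D) partial1of2 f a y = \int[mu]_(y in D) f' a y.
  by apply: eq_Rintegral => y _; exact: d1.
apply: cvg_trans cF; apply: near_eq_cvg; apply: nearW => h.
by rewrite [h *: 1]mulr1.
Qed.

End OneVariable.

Section Coordinates.
Context {R : realType}.

Lemma nice_scale {m : nat} (f : 'rV[R]_m -> R) (a : R) :
  0 < a -> nice f -> nice (fun z => f (a *: z)).
Proof.
move=> a0 nf; split.
  have -> : (fun z => f (a *: z)) \o rowt =
     (f \o rowt) \o (fun u : m.-tuple (measurableTypeR R) =>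
       [tuple a * tnth u i | i < m] : m.-tuple (measurableTypeR R)).
    apply/funext => u /=; congr f; apply/rowP => i; rewrite !mxE.
    by rewrite tnth_mktuple.
  apply: measurableT_comp; first exact: nf.1.
  apply/measurable_fun_tnthP => i.
  rewrite (_ : _ \o _ = (fun u => a * tnth u i)); last first.
    by apply/funext => u /=; rewrite tnth_mktuple.
  by apply: measurable_funM => //; exact: measurable_tnth.
(* The height [M] and the half-width [M / a] of the dilated function are merged into one
   constant. *)
have [M M0 fM] := nice_bound nf; exists (M + M / a) => z.
rewrite (le_trans (fM _))// /box.
have Ma0 : 0 <= M / a by rewrite divr_ge0// ltW.
case: (boolP [forall i, _]) => /= [/forallP zM|_]; last first.
  by rewrite mulr0 mulr_ge0// addr_ge0.
have -> : [forall i, `|z 0 i| <= M + M / a].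
  apply/forallP => i; move: (zM i); rewrite mxE normrM (gtr0_norm a0) => zi.
  by rewrite (@le_trans _ _ (M / a)) ?lerDr// ler_pdivlMr// mulrC.
by rewrite !mulr1 lerDl.
Qed.

Lemma row_consZ {m : nat} (a x : R) (z : 'rV[R]_m) :
  row_cons (a * x) (a *: z) = a *: row_cons x z.
Proof. by apply/rowP => i; rewrite !mxE; case: unliftP => [j _|_]; rewrite ?mxE. Qed.

(** The dilation is split off one coordinate at a time, each contributing a factor [a]. *)
Lemma Int_scale {m : nat} (f : 'rV[R]_m -> R) (a : R) : 0 < a -> nice f ->
  Int f = a ^+ m * Int (fun z => f (a *: z)).
Proof.
move=> a0; elim: m f => [|m IH] f nf.
  rewrite mul1r; congr Int; apply/funext => z; congr f.
  by apply/rowP => -[].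
rewrite (Int_cons nf) (Rintegral_scale a0 (integrable_Int_cons nf)).
have nfa := nice_scale a0 nf.
rewrite (Int_cons nfa) exprS -mulrA; congr (_ * _).
rewrite -RintegralZl//; last exact: (integrable_Int_cons nfa).
apply: eq_Rintegral => x _.
rewrite (IH _ (nice_cons _ nf)); congr (_ * Int _).
by apply/funext => z; rewrite row_consZ.
Qed.

Lemma row_cons_ord0 {m : nat} (x : R) (z : 'rV[R]_m) :
  row_cons x z = row_cons 0 z + x *: delta_mx 0 ord0.
Proof.
apply/rowP => i; rewrite !mxE; case: unliftP => [j ->|->] /=.
  by rewrite mulr0 addr0.
by rewrite mulr1 add0r.
Qed.

Lemma row_cons_lift {m : nat} (x s : R) (z : 'rV[R]_m) j :
  row_cons x (z + s *: delta_mx 0 j) = row_cons x z + s *: delta_mx 0 (lift ord0 j).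
Proof.
apply/rowP => i; rewrite !mxE; case: unliftP => [j' ->|->] /=.
  by rewrite !mxE (inj_eq lift_inj).
by rewrite mulr0 addr0.
Qed.

(** Fubini peels off the coordinates before [i]; once [i] is the head it is integrated innermost,
    where the fundamental theorem of calculus gives zero. *)
Lemma Int_derive0 {m : nat} (i : 'I_m) (G g : 'rV[R]_m -> R) (M : R) :
  nice g ->
  (forall z, is_derive z (delta_mx 0 i) G (g z)) ->
  (forall z, continuous (fun s : R => g (z + s *: delta_mx 0 i))) ->
  0 <= M -> (forall z, `|G z| <= box M z) ->
  Int g = 0.
Proof.
move=> + + + M0; elim: m i G g => [[]//|m IH] i G g ng dG cg GM.
have [j ij|i0] := unliftP ord0 i.
  rewrite Int_cons//.
  rewrite (_ : (fun x => _) = cst 0) ?Rintegral_cst ?mul0r//.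
  apply/funext => x; apply: (IH j (fun z => G (row_cons x z))).
  - exact: nice_cons.
  - move=> z; have /is_deriveP := dG (row_cons x z) => dGz; apply/is_deriveP.
    apply: cvg_trans dGz; apply: near_eq_cvg; apply: nearW => h.
    by rewrite ij (addrC (h *: _) z) row_cons_lift (addrC (row_cons x z)).
  - move=> z; have := cg (row_cons x z); rewrite ij.
    by under [X in _ -> continuous X]eq_fun do rewrite row_cons_lift.
  - move=> z; rewrite (le_trans (GM _))// box_cons//.
    by rewrite ler_piMl ?mulr_ge0// lern1 leq_b1.
rewrite Int_cons_swap// -[RHS](@Int0 R m); congr Int; apply/funext => z.
apply: (@Rintegral_derive0 _ (fun x => G (row_cons x z)) _ M).
- move=> x.
  have := (is_derive_line G (row_cons 0 z) (delta_mx 0 i) x _).1 (dG _).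
  by rewrite i0 -row_cons_ord0; under eq_fun do rewrite -row_cons_ord0.
- have := cg (row_cons 0 z); rewrite i0.
  by under eq_fun do rewrite -row_cons_ord0.
- move=> x Mx; apply/eqP; rewrite -normr_le0 (le_trans (GM _))// box_cons//.
  by have /negbTE -> : ~~ (`|x| <= M); rewrite ?mul0r// -ltNge.
Qed.

Lemma is_derive_Int {m : nat} (f f' : R -> 'rV[R]_m -> R) (a e M : R) : 0 < e ->
  (forall (x : R) z, `|x - a| < e -> is_derive x 1 (f ^~ z) (f' x z)) ->
  (forall x z, `|x - a| < e -> `|f' x z| <= box M z) ->
  (forall x, `|x - a| < e -> nice (f x)) ->
  is_derive a 1 (fun x => Int (f x)) (Int (f' a)).
Proof.
move=> e0 df fM nf.
have := @is_derive_Rintegral R _ _ (lebesgue_measure_tuple m) setT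
  (fun x u => f x (rowt u)) (fun x u => f' x (rowt u)) (box M \o rowt) a e
  measurableT e0.
move=> H; exact: (H (fun x u xa => df x (rowt u) xa) (fun x u xa => fM x (rowt u) xa)
  (integrable_box M) (fun x xa => nice_integrable (nf x xa))).
Qed.

End Coordinates.

(** * Divergence theorem on the unit ball *)

Section Cutoff.
Context {R : realType}.

Definition pos (x : R) : R := (x + `|x|) / 2.

Lemma pos_ge (x : R) : 0 <= x -> pos x = x.
Proof. by move=> x0; rewrite /pos ger0_norm//; field. Qed.

Lemma pos_le (x : R) : x <= 0 -> pos x = 0.
Proof. by move=> x0; rewrite /pos ler0_norm// subrr mul0r. Qed.

Lemma pos_ge0 (x : R) : 0 <= pos x.
Proof. by case: (leP 0 x) => [x0|/ltW x0]; [rewrite pos_ge|rewrite pos_le]. Qed.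

Lemma continuous_pos : continuous pos.
Proof.
move=> x; apply: cvgM; last exact: cvg_cst.
by apply: cvgD; [exact: cvg_id|apply: cvg_norm; exact: cvg_id].
Qed.

(** Squaring removes the corner of the positive part: at 0 the difference quotient lies between
    [-|h|] and [|h|]. *)
Lemma is_derive_pos2 (x : R) : is_derive x 1 (fun y => pos y ^+ 2) (2 * pos x).
Proof.
have [x0|x0|x0] := ltgtP x 0.
- rewrite (pos_le (ltW x0)) mulr0.
  have E : \forall y \near x, (cst 0 : R -> R) y = pos y ^+ 2.
    have : \forall y \near x, y < 0 by exact: lt_nbhsl.
    by apply: filterS => y y0; rewrite pos_le ?expr0n// ltW.
  exact: (near_eq_is_derive E (is_derive_cst _ _ _)).
- rewrite (pos_ge (ltW x0)).
  have E : \forall y \near x, y ^+ 2 = pos y ^+ 2.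
    have : \forall y \near x, 0 < y by exact: lt_nbhsr.
    by apply: filterS => y y0; rewrite pos_ge// ltW.
  apply: (near_eq_is_derive E).
  by apply: is_derive_eq; rewrite [x%:A]mulr1 mulr_natl.
- rewrite x0 pos_le// mulr0; apply/is_deriveP.
  have c0 : h @[h --> (0 : R)^'] --> (0 : R) by exact: cvg_within.
  have := cvg_norm c0; rewrite normr0 => /(_ _)/= cp0.
  have cp : `|h| @[h --> (0 : R)^'] --> (0 : R) by exact: cp0.
  have cn := cvgN cp; rewrite oppr0 in cn.
  apply: (@squeeze_cvgr _ _ _ _ (fun h => - `|h|) (fun h => `|h|)); last 2 first.
  + exact: cn.
  + exact: cp.
  rewrite near_withinE; apply: nearW => h h0.
  rewrite [h *: 1]mulr1 addr0 (pos_le (lexx 0)) expr0n subr0.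
  rewrite -ler_norml normrM normfV normrX ler_pdivrMl ?normr_gt0//.
  rewrite -expr2 ler_pXn2r ?nnegrE//.
  case: (leP 0 h) => [h0'|/ltW h0']; first by rewrite pos_ge.
  by rewrite pos_le ?normr0.
Qed.

(* A [C^1] step: [0] for [x <= 0] and [1] for [1 <= x]. *)
Definition step (x : R) : R := 1 - pos (1 - pos x ^+ 2) ^+ 2.

Definition dstep (x : R) : R := 4 * pos (1 - pos x ^+ 2) * pos x.

Lemma is_derive_step (x : R) : is_derive x 1 step (dstep x).
Proof.
have d1 : is_derive x 1 (fun y => 1 - pos y ^+ 2) (0 - 2 * pos x).
  by apply: is_deriveB; exact: is_derive_pos2.
have d2 := @is_derive1_comp R (fun y => pos y ^+ 2) (fun y => 1 - pos y ^+ 2) x _ _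
  (is_derive_pos2 (1 - pos x ^+ 2)) d1.
have d3 : is_derive x 1 step (0 - 2 * pos (1 - pos x ^+ 2) * (0 - 2 * pos x)).
  by apply: is_deriveB; exact: d2.
by apply: is_derive_eq; rewrite /dstep; ring.
Qed.

Lemma step_le0 (x : R) : x <= 0 -> step x = 0.
Proof. by move=> x0; rewrite /step (pos_le x0) expr0n subr0 pos_ge// expr1n subrr. Qed.

Lemma step_ge1 (x : R) : 1 <= x -> step x = 1.
Proof.
move=> x1; rewrite /step (pos_ge (le_trans ler01 x1)) pos_le ?expr0n ?subr0//.
by rewrite subr_le0 exprn_ege1.
Qed.

Lemma step_norm (x : R) : `|step x| <= 1.
Proof.
have p0 := pos_ge0 (1 - pos x ^+ 2).
have p1 : pos (1 - pos x ^+ 2) <= 1.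
  case: (leP 0 (1 - pos x ^+ 2)) => [h|/ltW h]; last by rewrite pos_le.
  by rewrite pos_ge// gerBl exprn_ge0// pos_ge0.
by rewrite ger0_norm ?subr_ge0 ?exprn_ile1// gerBl exprn_ge0.
Qed.

Lemma dstep_le0 (x : R) : x <= 0 -> dstep x = 0.
Proof. by move=> x0; rewrite /dstep (pos_le x0) mulr0. Qed.

Lemma dstep_ge1 (x : R) : 1 <= x -> dstep x = 0.
Proof.
move=> x1; rewrite /dstep (pos_ge (le_trans ler01 x1)) pos_le ?mulr0 ?mul0r//.
by rewrite subr_le0 exprn_ege1.
Qed.

(** Controls the cutoff error: at [x = N (1 - |z|^2)] the large factor [N] produced by
    differentiating the cutoff is absorbed in [x]. *)
Lemma mul_dstep_norm (x : R) : `|x * dstep x| <= 4.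
Proof.
case: (leP x 0) => [x0|x0]; first by rewrite dstep_le0// mulr0 normr0.
case: (leP 1 x) => [x1|x1]; first by rewrite dstep_ge1// mulr0 normr0.
rewrite /dstep (pos_ge (ltW x0)) pos_ge; last first.
  by rewrite subr_ge0 exprn_ile1// ltW.
rewrite ger0_norm; last first.
  by rewrite !mulr_ge0 ?ltW// subr_gt0 exprn_ilt1// ltW.
nra.
Qed.

Lemma continuous_dstep : continuous dstep.
Proof.
move=> x; apply: cvgM; last exact: continuous_pos.
apply: cvgM; first exact: cvg_cst.
apply: (@continuous_comp _ _ _ (fun x => 1 - pos x ^+ 2) pos); last first.
  exact: continuous_pos.
apply: cvgB; first exact: cvg_cst.
by apply: cvgM; exact: continuous_pos.
Qed.

Lemma continuous_step : continuous step.
Proof.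
move=> x; apply: differentiable_continuous; apply/derivable1_diffP.
exact: is_derive_derivable (is_derive_step x).
Qed.

End Cutoff.

Section ContinuousReal.
Context {R : realType} {T : topologicalType}.
Lemma contD (f g : T -> R) : continuous f -> continuous g -> continuous (fun x => f x + g x).
Proof. by move=> cf cg x; apply: cvgD; [exact: cf|exact: cg]. Qed.

Lemma contB (f g : T -> R) : continuous f -> continuous g -> continuous (fun x => f x - g x).
Proof. by move=> cf cg x; apply: cvgB; [exact: cf|exact: cg]. Qed.

Lemma contM (f g : T -> R) : continuous f -> continuous g -> continuous (fun x => f x * g x).
Proof. by move=> cf cg x; apply: cvgM; [exact: cf|exact: cg]. Qed.

Lemma cont_addv (W : normedModType R) (f g : T -> W) :
  continuous f -> continuous g -> continuous (fun x => f x + g x).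
Proof. by move=> cf cg x; apply: cvgD; [exact: cf|exact: cg]. Qed.

Lemma cont_scale (W : normedModType R) (f : T -> R) (g : T -> W) :
  continuous f -> continuous g -> continuous (fun x => f x *: g x).
Proof. by move=> cf cg x; apply: cvgZ; [exact: cf|exact: cg]. Qed.

Lemma cont_cst (a : R) : continuous (fun _ : T => a).
Proof. by move=> x; exact: cvg_cst. Qed.

Lemma cont_comp (f : T -> R) (psi : R -> R) :
  continuous f -> continuous psi -> continuous (fun x => psi (f x)).
Proof. by move=> cf cp x; apply: continuous_comp; [exact: cf|exact: cp]. Qed.

End ContinuousReal.

Lemma continuous_sum {R : realType} (T : topologicalType) (I : Type) (s : seq I)
    (F : I -> T -> R) :
  (forall i, continuous (F i)) -> continuous (fun x => \sum_(i <- s) F i x).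
Proof.
move=> cF; elim: s => [|i s IH] x.
  by under eq_fun do rewrite big_nil; exact: cvg_cst.
by under eq_fun do rewrite big_cons; apply: cvgD; [exact: cF|exact: IH].
Qed.

Section Ball.
Context {R : realType} {m : nat}.
Local Notation E := 'rV[R]_m.
Implicit Types (f g : E -> R) (z : E).

Definition sqn (z : 'rV[R]_m) : R := \sum_i z 0 i ^+ 2.

Definition bl (z : 'rV[R]_m) : R := (sqn z < 1)%R%:R.

Lemma is_derive_comp_dir (V : normedModType R) (f : V -> R) (p v : V)
    (psi : R -> R) (l l' : R) :
  is_derive p v f l -> is_derive (f p) 1 psi l' ->
  is_derive p v (psi \o f) (l' * l).
Proof.
move=> df dpsi.
have df0 : is_derive (p + 0 *: v) v f l by rewrite scale0r addr0.
have {}dpsi : is_derive (f (p + 0 *: v)) 1 psi l' by rewrite scale0r addr0.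
have d := is_derive1_comp dpsi ((is_derive_line f p v 0 l).1 df0).
have := (is_derive_line (psi \o f) p v 0 (l' * l)).2 d.
by rewrite scale0r addr0.
Qed.

Lemma sqn_line z i (s : R) :
  sqn (z + s *: delta_mx 0 i) = sqn z + (2 * s * z 0 i + s ^+ 2).
Proof.
rewrite /sqn (bigD1 i) //= [in RHS](bigD1 i) //= !mxE !eqxx.
rewrite (eq_bigr (fun j => z 0 j ^+ 2)); first by rewrite /= mulr1; ring.
by move=> j ji; rewrite !mxE (negbTE ji) mulr0 addr0.
Qed.

Lemma is_derive_sqn z i : is_derive z (delta_mx 0 i) sqn (2 * z 0 i).
Proof.
suff : is_derive (z + (0 : R) *: delta_mx 0 i) (delta_mx 0 i) sqn (2 * z 0 i).
  by rewrite scale0r addr0.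
apply/is_derive_line; under eq_fun do rewrite sqn_line.
by apply: is_derive_eq; rewrite /GRing.scale /=; ring.
Qed.

Lemma continuous_coord (i : 'I_m) : continuous (fun z : E => z 0 i).
Proof. by move=> z; apply: coord_continuous. Qed.

Lemma continuous_sqn : continuous sqn.
Proof.
apply: continuous_sum => i.
have : continuous (fun z : E => z 0 i * z 0 i).
  by apply: contM; exact: continuous_coord.
by under eq_fun do rewrite -expr2.
Qed.

Lemma sqn_coord z i : z 0 i ^+ 2 <= sqn z.
Proof.
rewrite /sqn (bigD1 i) //= lerDl sumr_ge0// => j _; exact: sqr_ge0.
Qed.

Lemma sqn_lt1_coord z i : sqn z < 1 -> `|z 0 i| <= 1.
Proof.
move=> z1; rewrite -(@ler_pXn2r _ 2) ?nnegrE// expr1n -normrX.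
by rewrite ger0_norm ?sqr_ge0// (le_trans (sqn_coord _ _))// ltW.
Qed.

Lemma bounded_on_box f (K : R) : continuous f ->
  exists M, forall z, (forall i, `|z 0 i| <= K) -> `|f z| <= M.
Proof.
move=> cf; pose A : set E := [set v | forall i, `[-K, K]%classic (v ord0 i)].
have cA : compact A.
  by apply: (@rV_compact R m (fun=> `[-K, K]%classic)) => i; exact: segment_compact.
have [M [_ fM]] := compact_bounded (continuous_compact (continuous_subspaceT cf) cA).
exists (M + 1) => z zK; apply: (fM (M + 1)); first by rewrite ltrDl.
by exists z => // i; rewrite /= in_itv /= -ler_norml; exact: zK.
Qed.

(** [1 <= M] puts the unit ball inside the cube of half-width [M]. *)
Lemma ball_le_box f (M : R) : 1 <= M -> (forall z, sqn z < 1 -> `|f z| <= M) ->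
  (forall z, 1 <= sqn z -> f z = 0) -> forall z, `|f z| <= box M z.
Proof.
move=> M1 fM f0 z; have [z1|z1] := ltP (sqn z) 1.
  rewrite box_in ?fM// => i; exact: le_trans (sqn_lt1_coord i z1) M1.
by rewrite f0// normr0 mulr_ge0// (le_trans ler01).
Qed.

Lemma continuous_ball_bound f : continuous f ->
  exists2 M, 1 <= M & forall z, sqn z < 1 -> `|f z| <= M.
Proof.
move=> /(@bounded_on_box _ 1)[M fM]; exists (1 + `|M|); first by rewrite lerDl.
move=> z z1; rewrite (@le_trans _ _ M) ?fM//.
  by move=> i; exact: sqn_lt1_coord.
by rewrite (le_trans (ler_norm _))// lerDr.
Qed.

Lemma nice_continuous_ball f : continuous f -> (forall z, 1 <= sqn z -> f z = 0) ->
  nice f.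
Proof.
move=> cf f0; split; first exact: measurable_rowt_continuous.
have [M M1 fM] := continuous_ball_bound cf.
by exists M; exact: ball_le_box.
Qed.

Lemma measurable_bl : measurable_fun [set: m.-tuple (measurableTypeR R)] (bl \o rowt).
Proof.
pose A := [set u : m.-tuple (measurableTypeR R) | sqn (rowt u) < 1].
have -> : bl \o rowt = \1_A.
  apply/funext => u; rewrite /= /bl indicE; congr (_%:R); congr nat_of_bool.
  by apply/idP/idP; rewrite inE.
apply: measurable_indic.
have mq := measurable_rowt_continuous continuous_sqn.
have := mq measurableT _ (measurable_itv `]-oo, 1[).
by rewrite setTI; congr measurable; apply/seteqP; split=> u; rewrite /A /= in_itv.
Qed.

Lemma nice_bl f : measurable_fun [set: m.-tuple (measurableTypeR R)] (f \o rowt) ->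
  (exists M, forall z, sqn z < 1 -> `|f z| <= M) -> nice (fun z => bl z * f z).
Proof.
move=> mf [M fM]; split; first exact: (measurable_funM measurable_bl mf).
exists (1 + `|M|); apply: ball_le_box; first by rewrite lerDl.
  move=> z z1; rewrite /bl z1 mul1r (le_trans (fM _ z1))//.
  by rewrite (le_trans (ler_norm _))// lerDr.
by move=> z z1; rewrite /bl ltNge z1 mul0r.
Qed.

Lemma nice_bl_continuous f : continuous f -> nice (fun z => bl z * f z).
Proof.
move=> cf; apply: nice_bl; first exact: measurable_rowt_continuous.
by have [M _ fM] := continuous_ball_bound cf; exists M.
Qed.

Lemma Int_dominated (f_ : nat -> E -> R) f (M : R) :
  (forall n, nice (f_ n)) -> nice f -> (forall n z, `|f_ n z| <= box M z) ->
  (forall z, f_ n z @[n --> \oo] --> f z) ->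
  Int (f_ n) @[n --> \oo] --> Int f.
Proof.
move=> nf_ nf fM ff.
have fin g : nice g ->
    (\int[lebesgue_measure_tuple m]_u (g (rowt u))%:E)%E = (Int g)%:E.
  move=> ng; rewrite /Int /Rintegral fineK//.
  exact: (integrable_fin_num measurableT (nice_integrable ng)).
have ffE u : (f_ n (rowt u))%:E @[n --> \oo] --> (f (rowt u))%:E.
  by apply: cvg_EFin; [exact: nearW|exact: ff].
have := @dominated_convergence _ _ R (lebesgue_measure_tuple m) setT measurableT
  (fun n u => (f_ n (rowt u))%:E) (fun u => (f (rowt u))%:E)
  (EFin \o (box M \o rowt)) (fun n => (measurable_EFinP _ _).2 (nf_ n).1)
  ((measurable_EFinP _ _).2 nf.1).
case=> [| | |_ _].
- by apply: aeW => u _; exact: ffE.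
- exact: integrable_box.
- by apply: aeW => u n _; rewrite /= lee_fin; exact: fM.
rewrite fin// => h; apply: fine_cvg; apply: cvg_trans h; apply: near_eq_cvg.
by apply: nearW => n; rewrite /= fin.
Qed.

(* The field [X] is tangent to the unit sphere, so cutting off near the sphere
   costs only a bounded term supported in a shrinking shell. *)
Lemma ball_divergence (X dX : 'I_m -> E -> R) (w : E -> R) :
  (forall i z, is_derive z (delta_mx 0 i) (X i) (dX i z)) ->
  (forall i, continuous (X i)) -> (forall i, continuous (dX i)) -> continuous w ->
  (forall z, \sum_i z 0 i * X i z = (sqn z - 1) * w z) ->
  Int (fun z => bl z * \sum_i dX i z) = 0.
Proof.
move=> dXE cX cdX cw Xw.
pose N n : R := n.+1%:R.
(* [step \o y n] vanishes outside the open ball and equals 1 where [1 - |z|^2 >= 1 / (n + 1)], so it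
   tends to the indicator of the open ball. *)
pose y n z := N n * (1 - sqn z).
have N1 n : 1 <= N n by rewrite /N ler1n.
have N0 n : 0 < N n by exact: lt_le_trans (N1 n).
have y0 n z : 1 <= sqn z -> y n z <= 0.
  by move=> z1; rewrite pmulr_rle0// subr_le0.
have dy n z i : is_derive z (delta_mx 0 i) (y n) (N n * (0 - 2 * z 0 i)).
  apply: (@is_deriveZ _ _ _ _ (N n)); apply: is_deriveB; exact: is_derive_sqn.
have dstepy n z i : is_derive z (delta_mx 0 i) (step \o y n)
    (dstep (y n z) * (N n * (0 - 2 * z 0 i))).
  exact: (@is_derive_comp_dir _ (y n) z _ step _ _ (dy n z i) (is_derive_step _)).
have cy n : continuous (y n).
  apply: contM; first exact: cont_cst.
  by apply: contB; [exact: cont_cst|exact: continuous_sqn].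
have csy n : continuous (fun z => step (y n z)).
  by apply: cont_comp; [exact: cy|exact: continuous_step].
have cdsy n : continuous (fun z => dstep (y n z)).
  by apply: cont_comp; [exact: cy|exact: continuous_dstep].
pose g n i z := step (y n z) * dX i z + X i z * (dstep (y n z) * (N n * (0 - 2 * z 0 i))).
have cg n i : continuous (g n i).
  apply: contD; first by apply: contM; [exact: csy|exact: cdX].
  apply: contM; first exact: cX.
  apply: contM; first exact: cdsy.
  apply: contM; first exact: cont_cst.
  apply: contB; first exact: cont_cst.
  by apply: contM; [exact: cont_cst|exact: continuous_coord].
have ng n i : nice (g n i).
  apply: nice_continuous_ball => // z z1.
  by rewrite /g step_le0 ?y0// dstep_le0 ?y0// !mul0r mulr0 addr0.
have Ig n i : Int (g n i) = 0.
  have [M M1 XM] := continuous_ball_bound (cX i).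
  apply: (@Int_derive0 _ _ i (fun z => step (y n z) * X i z) (g n i) M) => //.
  - by move=> z; apply: is_deriveM.
  - move=> z s; apply: (@continuous_comp _ _ _ (fun s : R => z + s *: delta_mx 0 i) (g n i)).
      apply: cvgD; first exact: cvg_cst.
      by apply: cvgZ; [exact: cvg_id|exact: cvg_cst].
    exact: cg.
  - by rewrite (le_trans ler01).
  - apply: ball_le_box => // z z1; last by rewrite step_le0 ?y0// mul0r.
    by rewrite normrM -[M]mul1r ler_pM// ?step_norm// XM.
(* The divergence of the cut-off field is [a + b]: [a] tends to the integrand on the ball, and [b]
   contains the gradient of the cutoff. In [b], the tangency identity for [z . X] turns [N dstep]
   into [y dstep], which is bounded and tends to 0 pointwise. *)
pose a n z := step (y n z) * \sum_i dX i z.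
pose b n z := 2 * (y n z * dstep (y n z)) * w z.
have ab n z : a n z + b n z = \sum_i g n i z.
  rewrite /g big_split /= -mulr_sumr; congr (_ + _).
  rewrite (eq_bigr (fun i => - 2 * N n * dstep (y n z) * (z 0 i * X i z))).
    by rewrite -mulr_sumr Xw /b /y; ring.
  by move=> i _; ring.
have cSdX : continuous (fun z => \sum_i dX i z) by exact: continuous_sum.
have na n : nice (a n).
  apply: nice_continuous_ball => [|z z1]; last by rewrite /a step_le0 ?y0// mul0r.
  by apply: contM; [exact: csy|exact: cSdX].
have nb n : nice (b n).
  apply: nice_continuous_ball => [|z z1].
    apply: contM; last exact: cw.
    apply: contM; first exact: cont_cst.
    by apply: contM; [exact: cy|exact: cdsy].
  by rewrite /b dstep_le0 ?y0// !mulr0 mul0r.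
have Iab n : Int (a n) = - Int (b n).
  apply/eqP; rewrite -subr_eq0 opprK -IntD//; apply/eqP.
  rewrite (_ : _ \+ _ = fun z => \sum_i g n i z); last first.
    by apply/funext => z; exact: ab.
  by rewrite Int_sum// big1.
have [Ma Ma1 aM] := continuous_ball_bound cSdX.
have [Mb Mb1 bM] := continuous_ball_bound cw.
have big z : sqn z < 1 -> \forall n \near \oo, 1 <= y n z.
  move=> z1; have d0 : 0 < 1 - sqn z by rewrite subr_gt0.
  near=> n; rewrite /y -ler_pdivrMr// div1r ltW//.
  rewrite invf_plt ?posrE// /N; near: n.
  exact: (near_infty_natSinv_lt (PosNum d0)).
have la : Int (a n) @[n --> \oo] --> Int (fun z => bl z * \sum_i dX i z).
  apply: (@Int_dominated _ _ Ma) => //.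
  - exact: nice_bl_continuous.
  - move=> n; apply: ball_le_box => // z z1; last by rewrite /a step_le0 ?y0// mul0r.
    by rewrite normrM -[Ma]mul1r ler_pM// ?step_norm// aM.
  - move=> z; rewrite /bl; have [z1|z1] := ltP (sqn z) 1.
      rewrite mul1r; apply: cvg_near_cst; apply: filterS (big z z1) => n yn.
      by rewrite /a step_ge1// mul1r.
    rewrite mul0r; apply: cvg_near_cst; apply: nearW => n.
    by rewrite /a step_le0 ?y0// mul0r.
have lb : Int (b n) @[n --> \oo] --> Int (fun _ : E => 0 : R).
  apply: (@Int_dominated _ _ (2 * 4 * Mb)) => //.
  - exact: nice0.
  - move=> n; apply: ball_le_box.
    + by lra.
    + move=> z z1; rewrite normrM ler_pM//; last exact: bM.
      by rewrite normrM (ger0_norm (ler0n _ 2)) ler_wpM2l// mul_dstep_norm.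
    + by move=> z z1; rewrite /b dstep_le0 ?y0// !mulr0 mul0r.
  - move=> z; have [z1|z1] := ltP (sqn z) 1.
      apply: cvg_near_cst; apply: filterS (big z z1) => n yn.
      by rewrite /b dstep_ge1// !mulr0 mul0r.
    apply: cvg_near_cst; apply: nearW => n.
    by rewrite /b dstep_le0 ?y0// !mulr0 mul0r.
have lb' := cvgN lb; rewrite Int0 oppr0 in lb'.
have la' : Int (a n) @[n --> \oo] --> (0 : R).
  rewrite (_ : (fun n => Int (a n)) = \- (fun n => Int (b n))); first exact: lb'.
  by apply/funext => n; rewrite Iab.
by rewrite -(cvg_lim (@Rhausdorff R) la) (cvg_lim (@Rhausdorff R) la').
Unshelve. all: by end_near. Qed.

End Ball.

(** * Ball means and the radial wave operator *)

Section BallMean.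
Context {R : realType} {m : nat}.
Local Notation E := 'rV[R]_m.
Local Notation V := (E * R)%type.
Implicit Types (h : V -> R) (z x : E) (p : V).

Lemma bounded_on_space_time_box (f : V -> R) (K : R) : continuous f ->
  exists M, forall p, (forall i, `|acoord p i| <= K) -> `|f p| <= M.
Proof.
move=> cf; pose A : set E := [set v | forall i, `[-K, K]%classic (v ord0 i)].
have cA : compact A.
  by apply: (@rV_compact R m (fun=> `[-K, K]%classic)) => i; exact: segment_compact.
have cB : compact (A `*` `[-K, K]%classic).
  by apply: compact_setX => //; exact: segment_compact.
have [M [_ fM]] := compact_bounded (continuous_compact (continuous_subspaceT cf) cB).
exists (M + 1) => p pK; apply: (fM (M + 1)); first by rewrite ltrDl.
exists p => //; split=> [i|] /=; rewrite in_itv /= -ler_norml.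
  exact: (pK (Some i)).
exact: (pK None).
Qed.

(* [dirs a h z p] is the [a]-th derivative of [h] at [p] in the space direction
   [z]. *)
Fixpoint dirs (a : nat) (h : V -> R) (z : E) (p : V) : R :=
  if a is a'.+1 then \sum_i z 0 i * dirs a' (partial (Some i) h) z p else h p.

Lemma continuous_dirs (T : topologicalType) a h (zeta : T -> E) (gamma : T -> V) :
  smooth h -> continuous zeta -> continuous gamma ->
  continuous (fun y => dirs a h (zeta y) (gamma y)).
Proof.
move=> + cz cg; elim: a h => [|a IH] h sh /=.
  move=> y; apply: continuous_comp; first exact: cg.
  exact: smooth_continuous.
apply: continuous_sum => i; apply: contM; last exact/IH/smooth_partial.
move=> y; apply: (@continuous_comp _ _ _ zeta (fun z => z 0 i)); first exact: cz.
exact: continuous_coord.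
Qed.

Lemma is_derive_dirs a h z p (al be : R) : smooth h ->
  is_derive p (al *: z, be) (dirs a h z)
    (al * dirs a.+1 h z p + be * dirs a (partial None h) z p).
Proof.
elim: a h => [|a IH] h sh.
  have := is_derive_dirD p (al *: z, be) sh.
  rewrite /dirD big_optionE /= addrC mulr_sumr; congr is_derive.
  by congr (_ + _); apply: eq_bigr => i _; rewrite mxE mulrA.
have := @is_derive_sum R V R m (fun i q => z 0 i * dirs a (partial (Some i) h) z q)
  p (al *: z, be) (fun i => z 0 i * (al * dirs a.+1 (partial (Some i) h) z p +
    be * dirs a (partial None (partial (Some i) h)) z p)).
have dz i : is_derive p (al *: z, be) (fun q => z 0 i * dirs a (partial (Some i) h) z q)
  (z 0 i * (al * dirs a.+1 (partial (Some i) h) z p +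
    be * dirs a (partial None (partial (Some i) h)) z p)).
  apply: (@is_deriveZ _ _ _ _ (z 0 i)); exact/IH/smooth_partial.
move=> /(_ dz); rewrite fct_sumE; congr is_derive.
rewrite [dirs a.+2 h z p]/= [dirs a.+1 (partial None h) z p]/= !mulr_sumr -big_split.
apply: eq_bigr => i _; rewrite (partialC None (Some i) sh) /=; ring.
Qed.

Section at_point.
Variables (c : R) (p0 : V).

Definition ball_pt (r tau : R) (z : E) : V := (p0.1 + (c * r) *: z, p0.2 + tau).

(* The partial derivative of order [(a, b)] in [(r, tau)] of the integral over
   the unit ball [|z| < 1] of [h (x + c r z, t + tau)], where [p0 = (x, t)]. *)
Definition ball_mean (a b : nat) (h : V -> R) (r tau : R) : R :=
  Int (fun z => bl z * (c ^+ a * dirs a (iter b (partial None) h) z (ball_pt r tau z))).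

Lemma smooth_iter_partial b i h : smooth h -> smooth (iter b (partial i) h).
Proof.
move=> sh; elim: b => [|b IH]; first exact: sh.
by rewrite iterS; exact: smooth_partial.
Qed.

Lemma continuous_pair (T : topologicalType) (f : T -> E) (g : T -> R) :
  continuous f -> continuous g -> continuous (fun y => (f y, g y)).
Proof. move=> cf cg y; exact: (cvg_pair (cf y) (cg y)). Qed.

Lemma continuous_affine (T : topologicalType) (f : T -> E) (a : T -> R) (x : E) :
  continuous f -> continuous a -> continuous (fun y => x + a y *: f y).
Proof.
by move=> cf ca y; apply: cvgD; [exact: cvg_cst|apply: cvgZ; [exact: ca|exact: cf]].
Qed.

Lemma continuous_ball_pt (r tau al be : R) :
  continuous (fun y : V => ball_pt (r + y.2 * al) (tau + y.2 * be) y.1).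
Proof.
apply: continuous_pair.
  apply: continuous_affine; first by move=> y; exact: cvg_fst.
  apply: contM; first exact: cont_cst.
  apply: contD; first exact: cont_cst.
  by apply: contM; [by move=> y; exact: cvg_snd|exact: cont_cst].
apply: contD; first exact: cont_cst.
apply: contD; first exact: cont_cst.
by apply: contM; [by move=> y; exact: cvg_snd|exact: cont_cst].
Qed.

Lemma continuous_ball_pt0 (r tau : R) : continuous (ball_pt r tau).
Proof.
apply: continuous_pair; last exact: cont_cst.
apply: continuous_affine; last exact: cont_cst.
by move=> z; exact: cvg_id.
Qed.

Lemma continuous_dirs_ball_pt a h (r tau : R) : smooth h ->
  continuous (fun z => dirs a h z (ball_pt r tau z)).
Proof.
move=> sh; apply: continuous_dirs => //; last exact: continuous_ball_pt0.
by move=> z; exact: cvg_id.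
Qed.

Lemma Int_bl_lin (f g : E -> R) (a b : R) : continuous f -> continuous g ->
  Int (fun z => bl z * (a * f z + b * g z)) =
  a * Int (fun z => bl z * f z) + b * Int (fun z => bl z * g z).
Proof.
move=> cf cg; have nf := nice_bl_continuous cf; have ng := nice_bl_continuous cg.
rewrite -!IntZ// -IntD; [|exact: niceZ|exact: niceZ].
by congr Int; apply/funext => z /=; ring.
Qed.

Lemma ball_pt_line (r tau al be s : R) z :
  ball_pt (r + s * al) (tau + s * be) z =
  ball_pt r tau z + s *: ((c * al) *: z, be).
Proof.
rewrite /ball_pt; congr (_, _); last by rewrite /= -addrA.
by rewrite /= scalerA -addrA -scalerDl; congr (_ + _ *: _); ring.
Qed.

(** The direction [(al, be)] is left arbitrary because the descent differentiates both along [r] and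
    along the diagonal. *)
Lemma is_derive_ball_mean a b h (r tau al be : R) : smooth h ->
  is_derive (0 : R) 1 (fun s => ball_mean a b h (r + s * al) (tau + s * be))
    (al * ball_mean a.+1 b h r tau + be * ball_mean a b.+1 h r tau).
Proof.
move=> sh; set h' := iter b (partial None) h.
have sh' : smooth h' by exact: smooth_iter_partial.
have sh'' : smooth (partial None h') by exact: smooth_partial.
pose P s z := ball_pt (r + s * al) (tau + s * be) z.
pose k s z := c ^+ a * ((c * al) * dirs a.+1 h' z (P s z) +
                        be * dirs a (partial None h') z (P s z)).
have cP a' h1 : smooth h1 -> continuous (fun y : V => dirs a' h1 y.1 (P y.2 y.1)).
  move=> sh1; apply: continuous_dirs => //; last exact: continuous_ball_pt.
  by move=> y; exact: cvg_fst.
(* The pair [(z, s)] is read as a point of space-time: joint continuity of [k] gives a bound uniform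
   in [|z| < 1] and [|s| < 1] by compactness. *)
have ck : continuous (fun y : V => k y.2 y.1).
  apply: contM; first exact: cont_cst.
  by apply: contD; (apply: contM; [exact: cont_cst|exact: cP]).
have [M kM] := bounded_on_space_time_box 1 ck.
have := @is_derive_Int R m
  (fun s z => bl z * (c ^+ a * dirs a h' z (P s z)))
  (fun s z => bl z * k s z) 0 1 (1 + `|M|) ltr01.
case.
- move=> s z _; apply: (@is_deriveZ _ _ _ _ (bl z)).
  apply: (@is_deriveZ _ _ _ _ (c ^+ a)).
  have := (is_derive_line (dirs a h' z) (ball_pt r tau z) ((c * al) *: z, be) s _).1
    (is_derive_dirs a z _ (c * al) be sh').
  rewrite -(ball_pt_line r tau al be s z).
  have -> : (fun s : R => dirs a h' z (ball_pt r tau z + s *: ((c * al) *: z, be))) =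
            (fun s => dirs a h' z (P s z)).
    by apply/funext => s'; rewrite /P ball_pt_line.
  exact.
- move=> s z; rewrite subr0 => s1; move: z; apply: ball_le_box.
  + by rewrite lerDl.
  + move=> z z1; rewrite /bl z1 mul1r (@le_trans _ _ M)//.
      apply: (kM (z, s)) => -[i|] /=; last exact: ltW.
      exact: sqn_lt1_coord.
    by rewrite (le_trans (ler_norm M))// lerDr.
  + by move=> z z1; rewrite /bl ltNge z1 mul0r.
- move=> s _; apply: nice_bl_continuous; apply: contM; first exact: cont_cst.
  exact: continuous_dirs_ball_pt.
move=> dF FE; split; first exact: dF.
rewrite FE /ball_mean -Int_bl_lin.
- congr Int; apply/funext => z; rewrite /k /P !mul0r !addr0 exprS iterS; ring.
- apply: contM; first exact: cont_cst.
  exact: (@continuous_dirs_ball_pt a.+1 h' r tau sh').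
- apply: contM; first exact: cont_cst.
  exact: (@continuous_dirs_ball_pt a _ r tau sh'').
Qed.

Lemma is_derive_coord (z : E) i j :
  is_derive z (delta_mx 0 i) (fun z => z 0 j) (i == j)%:R.
Proof.
suff : is_derive (z + (0 : R) *: delta_mx 0 i) (delta_mx 0 i) (fun z => z 0 j) (i == j)%:R.
  by rewrite scale0r addr0.
apply/is_derive_line; rewrite (_ : (fun s : R => _) = fun s => z 0 j + s * (i == j)%:R).
  by apply: is_derive_eq; rewrite /GRing.scale /=; ring.
by apply/funext => s; rewrite !mxE eqxx eq_sym.
Qed.

Lemma sum_delta (F : 'I_m -> R) i : \sum_j F j * (i == j)%:R = F i.
Proof.
rewrite (bigD1 i) //= eqxx mulr1 big1 ?addr0// => j ji.
by rewrite eq_sym (negbTE ji) mulr0.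
Qed.

(** The algebra of the divergence in [ball_mean_EPD]: there [b] is [c], [a] the point [z], [F] the
    gradient of [h], [S] its Hessian, [G] the diagonal of [S], and [D] the radial derivative
    [z . F]. *)
Lemma sum_divergence (b D r : R) (a F G : 'I_m -> R) (S : 'I_m -> 'I_m -> R) :
  \sum_i b * (D + a i * (F i + b * r * \sum_j a j * S i j) - b * r * G i) =
  b * m%:R * D + b * (\sum_i a i * F i) +
    b ^+ 2 * (r * (\sum_j a j * \sum_i a i * S i j) - r * \sum_i G i).
Proof.
rewrite (eq_bigr (fun i => b * D + b * (a i * F i) +
     b ^+ 2 * r * (\sum_j a i * (a j * S i j)) - b ^+ 2 * r * G i)); last first.
  by move=> i _; rewrite -mulr_sumr; ring.
rewrite sumrB 2!big_split /= sumr_const card_ord -!mulr_sumr exchange_big /=.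
have -> : \sum_(j < m) \sum_(i < m) a i * (a j * S i j) =
    \sum_j a j * \sum_i a i * S i j.
  apply: eq_bigr => j _; rewrite mulr_sumr.
  by apply: eq_bigr => i _; rewrite mulrCA.
by rewrite -mulr_natl; ring.
Qed.

(** The coefficient [m + 1], instead of the [m - 1] of spherical means, comes from the divergence of
    [z (z . grad h)]: [m] from the factor [z] and one more from differentiating [z] inside
    [z . grad h]. *)
Lemma ball_mean_EPD h (r tau : R) : smooth h ->
  r * ball_mean 2 0 h r tau + m.+1%:R * ball_mean 1 0 h r tau =
  r * (c ^+ 2 * Int (fun z => bl z *
    \sum_(i < m) partial (Some i) (partial (Some i) h) (ball_pt r tau z))).
Proof.
move=> sh; pose P := ball_pt r tau.
pose D (z : E) := dirs 1 h z (P z).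
pose L (z : E) := \sum_(i < m) partial (Some i) (partial (Some i) h) (P z).
(* [z . X] is [|z|^2 - 1] times [c (z . grad h)], so [X] is tangent to the unit sphere and
   [ball_divergence] applies. *)
pose X (i : 'I_m) (z : E) := c * (z 0 i * D z - partial (Some i) h (P z)).
pose dX (i : 'I_m) (z : E) := c * (D z + z 0 i * (partial (Some i) h (P z) +
   c * r * \sum_j z 0 j * partial (Some i) (partial (Some j) h) (P z)) -
   c * r * partial (Some i) (partial (Some i) h) (P z)).
have cP : continuous P by exact: continuous_ball_pt0.
have cF f : smooth f -> continuous (fun z => f (P z)).
  move=> sf z; apply: continuous_comp; first exact: cP.
  exact: smooth_continuous.
have sp i : smooth (partial i h) by exact: smooth_partial.
have spp i j : smooth (partial i (partial j h)) by exact: (smooth_partial i (sp j)).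
have cD : continuous D by exact: continuous_dirs_ball_pt.
have cL : continuous L by apply: continuous_sum => i; exact: (cF _ (spp (Some i) (Some i))).
have dF f i z : smooth f ->
    is_derive z (delta_mx 0 i) (fun z => f (P z)) (c * r * partial (Some i) f (P z)).
  move=> sf.
  have dl : is_derive (P z + (0 : R) *: ((c * r) *: axis (Some i))) ((c * r) *: axis (Some i)) f
      (c * r * partial (Some i) f (P z)).
    by rewrite scale0r addr0; apply: is_deriveZv; exact: is_derive_axis.
  move/is_derive_line : dl.
  have E s : f (P z + s *: ((c * r) *: axis (Some i))) =
             (fun z => f (P z)) (z + s *: delta_mx 0 i).
    congr f; rewrite /P /ball_pt /=; congr (_, _); last by rewrite /= !scaler0 addr0.
    by rewrite /= scalerDr addrA !scalerA (mulrC s).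
  under eq_fun do rewrite E.
  move=> dl; have := (is_derive_line (fun z => f (P z)) z (delta_mx 0 i) 0 _).2 dl.
  by rewrite scale0r addr0.
have dD i z : is_derive z (delta_mx 0 i) D (partial (Some i) h (P z) +
   c * r * \sum_j z 0 j * partial (Some i) (partial (Some j) h) (P z)).
  have := @is_derive_sum R E R m (fun j z => z 0 j * partial (Some j) h (P z))
    z (delta_mx 0 i) (fun j => z 0 j * (c * r * partial (Some i) (partial (Some j) h) (P z)) +
      partial (Some j) h (P z) * (i == j)%:R).
  have dj j : is_derive z (delta_mx 0 i) (fun z => z 0 j * partial (Some j) h (P z))
     (z 0 j * (c * r * partial (Some i) (partial (Some j) h) (P z)) +
      partial (Some j) h (P z) * (i == j)%:R).
    apply: is_deriveM; first exact: is_derive_coord.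
    exact: (dF _ i z (sp (Some j))).
  move=> /(_ dj); rewrite fct_sumE; congr is_derive.
  rewrite big_split /= addrC; congr (_ + _).
    exact: (sum_delta (fun j => partial (Some j) h (P z))).
  by rewrite mulr_sumr; apply: eq_bigr => j _; ring.
have dXE i z : is_derive z (delta_mx 0 i) (X i) (dX i z).
  have -> : dX i z = c * (z 0 i * (partial (Some i) h (P z) +
     c * r * \sum_j z 0 j * partial (Some i) (partial (Some j) h) (P z)) + D z * (i == i)%:R -
     c * r * partial (Some i) (partial (Some i) h) (P z)).
    by rewrite eqxx mulr1 /dX; ring.
  apply: (@is_deriveZ _ _ _ _ c).
  apply: is_deriveB; last exact: (dF _ i z (sp (Some i))).
  by apply: is_deriveM; exact: is_derive_coord.
have cX i : continuous (X i).
  apply: contM; first exact: cont_cst.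
  apply: contB; last exact: (cF _ (sp (Some i))).
  by apply: contM; [exact: continuous_coord|exact: cD].
have cdX i : continuous (dX i).
  apply: contM; first exact: cont_cst.
  apply: contB; last first.
    apply: contM; first exact: cont_cst.
    exact: (cF _ (spp (Some i) (Some i))).
  apply: contD; first exact: cD.
  apply: contM; first exact: continuous_coord.
  apply: contD; first exact: (cF _ (sp (Some i))).
  apply: contM; first exact: cont_cst.
  apply: continuous_sum => j; apply: contM; first exact: continuous_coord.
  exact: (cF _ (spp (Some i) (Some j))).
have cD2 : continuous (fun z => c * D z) by apply: contM; [exact: cont_cst|exact: cD].
have SX z : \sum_i z 0 i * X i z = (sqn z - 1) * (c * D z).
  rewrite (eq_bigr (fun i => c * D z * z 0 i ^+ 2 -
      c * (z 0 i * partial (Some i) h (P z)))).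
    rewrite sumrB -!mulr_sumr -/(sqn z) -[\sum_i z 0 i * _]/(D z); ring.
  by move=> i _; rewrite /X; ring.
have := @ball_divergence R m X dX (fun z => c * D z) dXE cX cdX cD2 SX.
have SdX z : \sum_i dX i z = c * m.+1%:R * D z +
    c ^+ 2 * (r * dirs 2 h z (P z) - r * L z).
  have := sum_divergence c (D z) r (fun i => z 0 i) (fun i => partial (Some i) h (P z))
    (fun i => partial (Some i) (partial (Some i) h) (P z))
    (fun i j => partial (Some i) (partial (Some j) h) (P z)).
  move=> /= ->; rewrite -[\sum_i z 0 i * partial _ h _]/(D z) -/(L z).
  by rewrite -[m.+1]addn1 natrD; ring.
rewrite (_ : (fun z => _) = (fun z => bl z * (c * m.+1%:R * D z +
   c ^+ 2 * (r * dirs 2 h z (P z) - r * L z)))); last by apply/funext => z; rewrite SdX.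
rewrite Int_bl_lin//; last first.
  apply: contB; (apply: contM; first exact: cont_cst) => //.
  exact: continuous_dirs_ball_pt.
have -> : (fun z => bl z * (r * dirs 2 h z (P z) - r * L z)) =
          (fun z => bl z * (r * dirs 2 h z (P z) + - r * L z)).
  by apply/funext => z; rewrite mulNr.
rewrite Int_bl_lin//; last exact: continuous_dirs_ball_pt.
rewrite /ball_mean.
have E a f : continuous f -> Int (fun z : E => bl z * (c ^+ a * f z)) =
    c ^+ a * Int (fun z => bl z * f z).
  move=> cf; rewrite -IntZ; last exact: nice_bl_continuous.
  by congr Int; apply/funext => z; ring.
rewrite (E 2)//; last exact: continuous_dirs_ball_pt.
rewrite (E 1) ?expr1//.
rewrite -/P -/(L _) => h0; apply/eqP; rewrite -subr_eq0; apply/eqP; rewrite -[RHS]h0.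
ring.
Qed.

End at_point.
End BallMean.

(** * Descent of the radial wave operator along the diagonal *)

Section RadialLadder.
Context {R : realType}.
Local Notation lambda := (@lebesgue_measure R).
Implicit Types D : nat -> nat -> R -> R -> R.

(* [D a b] stands for the partial derivative of order [(a, b)] of a function of
   [(r, tau)]. *)
Definition radial_family D := forall a b (r tau al be : R),
  is_derive (0 : R) 1 (fun s => D a b (r + s * al) (tau + s * be))
    (al * D a.+1 b r tau + be * D a b.+1 r tau).

(* [D1] is the image of [D] under the operator
   [d^2/dtau^2 - d^2/dr^2 - ((2q + 2) / r) d/dr]; multiplying by [r] makes the
   relation meaningful at [r = 0]. *)
Definition EPD (q : nat) D D1 := forall r tau : R,
  r * (D 0%N 2%N r tau - D 2%N 0%N r tau) - q.+1.*2%:R * D 1%N 0%N r tau =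
  r * D1 0%N 0%N r tau.

Lemma natr_dbl (q : nat) : q.*2%:R = 2 * q%:R :> R.
Proof. by rewrite -mul2n natrM. Qed.

(* Intertwines the operators of [EPD] with parameters [q] and [q.-1]. *)
Definition ladder (q : nat) D : nat -> nat -> R -> R -> R :=
  fun a b r tau => r * D a.+1 b r tau + (a + q.*2.+1)%:R * D a b r tau.

(** Leibniz: each [r]-derivative of [r v_r] adds one more copy of the lower-order term, whence the
    coefficient [a + q.*2.+1] in [ladder]. *)
Lemma radial_family_ladder q D : radial_family D -> radial_family (ladder q D).
Proof.
move=> fD a b r tau al be.
have d0 := fD a b r tau al be; have d1 := fD a.+1 b r tau al be.
have dr : is_derive (0 : R) 1 (fun s : R => r + s * al) al.
  by apply: is_derive_eq; rewrite /GRing.scale /=; ring.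
have d2 := is_deriveM dr d1.
have d3 := @is_deriveZ _ _ _ _ (a + q.*2.+1)%:R _ _ _ d0.
have := is_deriveD d2 d3.
congr is_derive; rewrite /GRing.scale /= !mul0r !addr0 /ladder.
by rewrite addSn -natr1; ring.
Qed.

(** The new equation is [r] times the [r]-derivative of the old one plus [2q + 2] times the old one
    itself. *)
Lemma EPD_ladder q D D1 : radial_family D -> radial_family D1 ->
  EPD q.+1 D D1 -> EPD q (ladder q.+1 D) (ladder q.+1 D1).
Proof.
move=> fD fD1 E r tau.
have dr : is_derive (0 : R) 1 (fun s : R => r + s * 1) 1.
  by apply: is_derive_eq; rewrite /GRing.scale /=; ring.
have d02 := fD 0%N 2%N r tau 1 0; have d20 := fD 2%N 0%N r tau 1 0.
have d10 := fD 1%N 0%N r tau 1 0; have d1 := fD1 0%N 0%N r tau 1 0.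
have dl := is_deriveB (is_deriveM dr (is_deriveB d02 d20))
  (@is_deriveZ _ _ _ _ q.+2.*2%:R _ _ _ d10).
have dR := is_deriveM dr d1.
have EF : (fun s => r + s * 1) * ((fun s => D 0%N 2%N (r + s * 1) (tau + s * 0)) -
     (fun s => D 2%N 0%N (r + s * 1) (tau + s * 0))) -
   q.+2.*2%:R \*: (fun s => D 1%N 0%N (r + s * 1) (tau + s * 0)) =
   (fun s => r + s * 1) * (fun s => D1 0%N 0%N (r + s * 1) (tau + s * 0)).
  by apply/funext => s; exact: E.
rewrite EF in dl; have := is_derive_unique dl dR.
rewrite /GRing.scale /= !fctE /= !mul0r !addr0 => E'.
have E0 := E r tau.
rewrite /ladder !natrD -!natr1 !natr_dbl -!natr1 in E' E0 *.
rewrite !mul1r !mulr1 ?mulr0 ?addr0 in E'.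
have E1 := congr1 ( *%R r) E'; have E2 := congr1 ( *%R (2 * q%:R + 2)) E0.
lra.
Qed.
Lemma is_derive_diag D a b (r : R) : radial_family D ->
  is_derive r 1 (fun s => D a b s s) (D a.+1 b r r + D a b.+1 r r).
Proof.
move=> fD; have := fD a b r r 1 1; rewrite !mul1r => d.
have := (is_derive_line (fun s => D a b s s) r (1 : R) 0 _).2 d.
by rewrite scale0r addr0.
Qed.

Lemma continuous_diag D a b : radial_family D -> continuous (fun s => D a b s s).
Proof.
move=> fD r; apply: differentiable_continuous; apply/derivable1_diffP.
exact: is_derive_derivable (is_derive_diag a b r fD).
Qed.

Lemma continuous_integrable_itv (f : R -> R) (a b : R) : continuous f ->
  lambda.-integrable `[a, b] (EFin \o f).
Proof.
move=> cf; apply: continuous_compact_integrable; first exact: segment_compact.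
exact: continuous_subspaceT.
Qed.

Lemma is_derive_exprn n (r : R) : is_derive r 1 (fun s => s ^+ n) (n%:R * r ^+ n.-1).
Proof.
have := @is_deriveX R R id n r 1 1 (is_derive_id r (1 : R)).
by rewrite exprfctE [_%:A]mulr1.
Qed.

Lemma continuous_exprn n : continuous (fun s : R => s ^+ n).
Proof. exact: exprn_continuous. Qed.

(** Vanishing at [tau = T] removes the boundary term at [T]. The one at 0 carries the factor
    [r ^+ q.*2], so it survives for [q = 0] only. *)
Lemma radial_integral_step q D D1 (T : R) : 0 <= T -> radial_family D ->
  radial_family D1 -> (forall a b r, D a b r T = 0) -> EPD q D D1 ->
  \int[lambda]_(r in `[0, T]) (r ^+ q.*2.+1 * D1 0%N 0%N r r) =
  q.*2%:R * \int[lambda]_(r in `[0, T]) (r ^+ q.*2.-1 * ladder q D 0%N 0%N r r)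
  + (q == 0%N)%:R * D 0%N 0%N 0 0.
Proof.
move=> T0 fD fD1 DT E.
pose A r := r ^+ q.*2.+1 * D1 0%N 0%N r r.
pose B r := r ^+ q.*2.-1 * ladder q D 0%N 0%N r r.
(* [F] is the antiderivative along the diagonal of the difference of the two
   integrands. *)
pose F r := r ^+ q.*2.+1 * (D 0%N 1%N r r - D 1%N 0%N r r) -
            q.*2.+1%:R * (r ^+ q.*2 * D 0%N 0%N r r).
have cA : continuous A.
  by apply: contM; [exact: continuous_exprn|exact: continuous_diag].
have cB : continuous B.
  apply: contM; first exact: continuous_exprn.
  exact: (@continuous_diag (ladder q D) 0%N 0%N (radial_family_ladder q fD)).
have c2B : continuous (fun r => q.*2%:R * B r) by apply: contM => //; exact: cont_cst.
have dF (r : R) : is_derive r 1 F (A r - q.*2%:R * B r).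
  have d1 := is_deriveM (is_derive_exprn q.*2.+1 r)
    (is_deriveB (is_derive_diag 0%N 1%N r fD) (is_derive_diag 1%N 0%N r fD)).
  have d2 := is_deriveM (is_derive_exprn q.*2 r) (is_derive_diag 0%N 0%N r fD).
  have := is_deriveB d1 (@is_deriveZ _ _ _ _ q.*2.+1%:R _ _ _ d2).
  congr is_derive; rewrite /A /B /ladder /GRing.scale /= !fctE add0n.
  have -> : r ^+ q.*2.+1 * D1 0%N 0%N r r = r ^+ q.*2 * (r * D1 0%N 0%N r r).
    by rewrite exprSr mulrA.
  (* For [q = 0] the truncated exponent [q.*2.-1] is 0 and [r * r ^+ q.*2.-1] is not [r ^+ q.*2];
     the coefficient [q.*2] then cancels that term. *)
  rewrite -(E r r); case: q {E DT A B F cA cB c2B d1 d2} => [|q] /=.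
    by rewrite !doubleS double0 expr1 expr0; ring.
  by rewrite !doubleS !exprS -!natr1 !natr_dbl; ring.
have <- : F T - F 0 = (q == 0%N)%:R * D 0%N 0%N 0 0.
  rewrite /F !DT subrr !mulr0 subr0 sub0r expr0n /= mul0r sub0r opprK.
  by rewrite expr0n; case: q {E A B F cA cB c2B dF} => [|q] /=; rewrite ?mul1r ?mul0r ?mulr0.
rewrite -(Rintegral_FTC2 T0 dF); last exact: contB.
rewrite RintegralB//; last 2 first.
- exact: continuous_integrable_itv.
- exact: continuous_integrable_itv.
rewrite RintegralZl//; last exact: continuous_integrable_itv.
by rewrite addrC subrK.
Qed.

(* Each integration by parts trades one application of the wave operator for one
   of [ladder], which lowers [q] and so reaches the boundary term of [q = 0]. *)
Lemma radial_integral q (D : nat -> nat -> nat -> R -> R -> R) (T : R) :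
  0 <= T -> (forall j, radial_family (D j)) ->
  (forall j, EPD q (D j) (D j.+1)) ->
  (forall j a b r, D j a b r T = 0) ->
  \int[lambda]_(r in `[0, T]) (r ^+ q.*2.+1 * D q.+1 0%N 0%N r r) =
  (q.*2.+1)`!%:R * D 0%N 0%N 0%N 0 0.
Proof.
move=> T0; elim: q D => [|q IH] D fD ED DT.
  rewrite (radial_integral_step T0 (fD 0%N) (fD 1%N) (DT 0%N) (ED 0%N)) /=.
  by rewrite mul0r add0r.
rewrite (radial_integral_step T0 (fD q.+1) (fD q.+2) (DT q.+1) (ED q.+1)) /= mul0r addr0.
have := IH (fun j => ladder q.+1 (D j)) (fun j => radial_family_ladder q.+1 (fD j))
  (fun j => EPD_ladder (fD j) (fD j.+1) (ED j)).
rewrite /= => -> => [|j a b r]; last by rewrite /ladder !DT !mulr0 addr0.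
(* At [r = 0] the ladder multiplies by [2q + 3]; with the factor [2q + 2] of the step this extends
   [(2q + 1)!] to [(2q + 3)!]. *)
rewrite /ladder mul0r add0r add0n.
rewrite mulrA mulrA -!natrM; congr (_%:R * _).
by rewrite doubleS !factS; lia.
Qed.

End RadialLadder.

(** * Vanishing on open sets and the integral identity for ball means *)

Section FutureVanishing.
Context {R : realType} {m : nat}.
Local Notation E := 'rV[R]_m.
Local Notation V := (E * R)%type.
Implicit Types (f h : V -> R) (U : set V).

Lemma partial_open0 f i U : smooth f -> open U -> (forall p, U p -> f p = 0) ->
  forall p, U p -> partial i f p = 0.
Proof.
move=> sf oU f0 p Up; apply: (is_derive_unique (is_derive_axis i p sf)).
have E0 : \forall q \near p, (cst 0 : V -> R) q = f q.
  have : nbhs p U by exact: open_nbhs_nbhs.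
  by apply: filterS => q /f0 ->.
exact: (near_eq_is_derive E0 (is_derive_cst _ _ _)).
Qed.

Lemma dalembertian_open0 phi f U : smooth f -> open U ->
  (forall p, U p -> f p = 0) -> forall p, U p -> dalembertian phi f p = 0.
Proof.
move=> sf oU f0 p Up.
have pp i q : U q -> partial i (partial i f) q = 0.
  apply: (@partial_open0 (partial i f)) => //; first exact: smooth_partial.
  exact: partial_open0.
rewrite dalembertianE /= pp// add0r big1 ?mulr0// => i _; exact: pp.
Qed.

Lemma iter_dalembertian_open0 phi n f U : smooth f -> open U ->
  (forall p, U p -> f p = 0) -> forall p, U p -> iter n (dalembertian phi) f p = 0.
Proof.
move=> sf oU f0; elim: n => [|n IH]; first exact: f0.
rewrite iterS; apply: dalembertian_open0 => //.
exact: smooth_iter_dalembertian.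
Qed.

Lemma iter_partial_open0 i n f U : smooth f -> open U ->
  (forall p, U p -> f p = 0) -> forall p, U p -> iter n (partial i) f p = 0.
Proof.
move=> sf oU f0; elim: n => [|n IH]; first exact: f0.
rewrite iterS; apply: partial_open0 => //.
exact: smooth_iter_partial.
Qed.

Lemma dirs_open0 a f z U : smooth f -> open U ->
  (forall p, U p -> f p = 0) -> forall p, U p -> dirs a f z p = 0.
Proof.
move=> + oU; elim: a f => [|a IH] f sf f0 p Up; first exact: f0.
rewrite /= big1// => i _; rewrite IH ?mulr0//; first exact: smooth_partial.
exact: partial_open0.
Qed.

Definition future (t0 : R) : set V := [set p | t0 < p.2].

Lemma open_future t0 : open (future t0).
Proof.
have cs : continuous (fun p : V => p.2) by move=> p; exact: cvg_snd.
exact: (open_comp (fun p _ => cs p) (open_gt (y := t0))).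
Qed.

End FutureVanishing.

Section Core.
Context {R : realType} {m : nat}.
Local Notation lambda := (@lebesgue_measure R).
Local Notation V := ('rV[R]_m * R)%type.
Implicit Types (h : V -> R).

Lemma ball_mean_future0 (c : R) (p0 : V) a b h t0 (r tau : R) : smooth h ->
  (forall p, future t0 p -> h p = 0) -> t0 < p0.2 + tau ->
  ball_mean c p0 a b h r tau = 0.
Proof.
move=> sh h0 tau0; rewrite /ball_mean -[RHS](@Int0 R m); congr Int.
apply/funext => z; rewrite (@dirs_open0 _ _ _ _ _ (future t0)) ?mulr0//.
- exact: smooth_iter_partial.
- exact: open_future.
- by apply: iter_partial_open0 => //; exact: open_future.
Qed.

(** Derivatives in [tau] fall on [h] as time derivatives, and the Laplacian is supplied by
    [ball_mean_EPD], whose coefficient [m + 1] is the [2q + 2] of [EPD]. *)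
Lemma EPD_ball_mean phi (p0 : V) q h : smooth h -> m = q.*2.+1 ->
  EPD q (fun a b => ball_mean (tan phi) p0 a b h)
        (fun a b => ball_mean (tan phi) p0 a b (dalembertian phi h)).
Proof.
move=> sh mq r tau.
have E := ball_mean_EPD (tan phi) p0 r tau sh.
have -> : q.+1.*2 = m.+1 by rewrite mq doubleS.
pose P := ball_pt (tan phi) p0 r tau.
have cP : continuous P by exact: continuous_ball_pt0.
have cF f : smooth f -> continuous (fun z => f (P z)).
  move=> sf z; apply: continuous_comp; first exact: cP.
  exact: smooth_continuous.
have -> : ball_mean (tan phi) p0 0 0 (dalembertian phi h) r tau =
    1 * ball_mean (tan phi) p0 0 2 h r tau + - tan phi ^+ 2 * Int (fun z => bl z *
     \sum_(i < m) partial (Some i) (partial (Some i) h) (P z)).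
  rewrite -Int_bl_lin.
  - congr Int; apply/funext => z; rewrite dalembertianE /= !expr0; congr (_ * _); ring.
  - apply: contM; first exact: cont_cst.
    by apply: cF; do 2 apply: smooth_partial.
  - exact: (cF _ (smooth_laplacian_space sh)).
rewrite mulrBr -addrA -opprD E -/P; ring.
Qed.

(** [radial_integral] applied to the iterates of the d'Alembertian. At [r = tau = 0] the ball
    shrinks to [p0], leaving the volume of the unit ball as a factor. *)
Lemma ball_mean_core phi (p0 : V) q h (t0 T : R) : smooth h -> m = q.*2.+1 ->
  (forall p, future t0 p -> h p = 0) -> 0 <= T -> t0 < p0.2 + T ->
  \int[lambda]_(r in `[0, T])
    (r ^+ m * ball_mean (tan phi) p0 0 0 (iter q.+1 (dalembertian phi) h) r r) =
  m`!%:R * Int (@bl R m) * h p0.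
Proof.
move=> sh mq h0 T0 t0T.
have sj j := smooth_iter_dalembertian phi j sh.
have := @radial_integral R q
  (fun j a b => ball_mean (tan phi) p0 a b (iter j (dalembertian phi) h)) T T0
  (fun j a b r tau al be => is_derive_ball_mean _ _ a b r tau al be (sj j))
  (fun j => EPD_ball_mean phi p0 (sj j) mq).
rewrite -mq => ->; last first.
  move=> j a b r; apply: (ball_mean_future0 _ _ _ _ (sj j) _ t0T).
  by apply: iter_dalembertian_open0 => //; exact: open_future.
rewrite -mulrA; congr (_ * _).
rewrite /ball_mean /= mulrC -IntZ.
  congr Int; apply/funext => z; rewrite expr0 mul1r mulrC; congr (h _ * _).
  by rewrite /ball_pt mulr0 scale0r !addr0 -surjective_pairing.
have -> : (@bl R m) = (fun z => bl z * 1) by apply/funext => z; rewrite mulr1.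
by apply: nice_bl_continuous; exact: cont_cst.
Qed.

End Core.

(** * Integration over the cone *)

Section ConeIntegral.
Context {R : realType} {m : nat}.
Local Notation lambda := (@lebesgue_measure R).
Local Notation E := 'rV[R]_m.
Local Notation V := (E * R)%type.
Implicit Types (F : V -> R).

Lemma measurable_lt0 {n : nat} (g : 'rV[R]_n -> R) : continuous g ->
  measurable_fun [set: n.-tuple (measurableTypeR R)]
    ((fun z => (g z < 0)%R%:R : R) \o rowt).
Proof.
move=> cg; pose A := [set u : n.-tuple (measurableTypeR R) | g (rowt u) < 0].
have -> : (fun z => (g z < 0)%R%:R : R) \o rowt = \1_A :> (n.-tuple (measurableTypeR R) -> R).
  apply/funext => u; rewrite /= indicE; congr (_%:R); congr nat_of_bool.
  by apply/idP/idP; rewrite inE.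
apply: measurable_indic.
have := measurable_rowt_continuous cg measurableT (measurable_itv `]-oo, 0[).
by rewrite setTI; congr measurable; apply/seteqP; split=> u; rewrite /A /= in_itv.
Qed.

Definition row_tail (w : 'rV[R]_m.+1) : E := \row_j w 0 (lift ord0 j).

Lemma row_tail_cons (r : R) (u : E) : row_tail (row_cons r u) = u.
Proof. by apply/rowP => j; rewrite !mxE liftK. Qed.

Lemma row_cons_head (r : R) (u : E) : row_cons r u 0 ord0 = r.
Proof. by rewrite mxE unlift_none. Qed.

Lemma continuous_row_tail : continuous row_tail.
Proof.
rewrite (_ : row_tail =
    (fun w => \sum_j w 0 (lift ord0 j) *: (delta_mx 0 j : E))); last first.
  by apply/funext => w; rewrite [LHS]row_sum_delta; apply: eq_bigr => j _; rewrite mxE.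
elim: (index_enum _) => [|j s IH].
  rewrite (_ : (fun w => _) = cst (0 : E)); first exact: cst_continuous.
  by apply/funext => w; rewrite big_nil.
rewrite (_ : (fun w => _) = (fun w : 'rV[R]_m.+1 => w 0 (lift ord0 j) *: (delta_mx 0 j : E) +
    \sum_(j <- s) w 0 (lift ord0 j) *: (delta_mx 0 j : E))); last first.
  by apply/funext => w; rewrite big_cons.
apply: cont_addv => //; apply: cont_scale; last exact: cst_continuous.
exact: continuous_coord.
Qed.

Lemma enorm_sqn (u : E) : enorm u = Num.sqrt (sqn u).
Proof. by []. Qed.

Lemma continuous_enorm : continuous (@enorm R m).
Proof. by apply: (cont_comp (@continuous_sqn R m)); exact: sqrt_continuous. Qed.

Lemma sqn_ge0 (u : E) : 0 <= sqn u.
Proof. by apply: sumr_ge0 => i _; exact: sqr_ge0. Qed.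

Lemma coord_le_enorm (u : E) i : `|u 0 i| <= enorm u.
Proof.
rewrite enorm_sqn -(@ler_pXn2r _ 2) ?nnegrE ?sqrtr_ge0// -normrX ger0_norm ?sqr_ge0//.
by rewrite sqr_sqrtr ?sqn_ge0// sqn_coord.
Qed.

Lemma continuous_cone (p : V) (a : R) :
  continuous (fun u : E => (p.1 + u, p.2 + a * enorm u)).
Proof.
apply: continuous_pair.
  by apply: cont_addv; [exact: cst_continuous|move=> u; exact: cvg_id].
apply: contD; first exact: cont_cst.
by apply: contM; [exact: cont_cst|exact: continuous_enorm].
Qed.

(** Once [a |u| > t0 - p.2] the point of the cone is later than [t0]; vanishing in the future thus
    bounds the support on each cone, whatever [F] does in space and in the past. *)
Lemma cone_box F (p : V) (a t0 : R) : 0 < a -> continuous F ->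
  (forall q, future t0 q -> F q = 0) ->
  exists K, forall u, `|F (p.1 + u, p.2 + a * enorm u)| <= box K u.
Proof.
move=> a0 cF F0; pose K := `|(t0 - p.2) / a|.
have cFu : continuous (fun u => F (p.1 + u, p.2 + a * enorm u)).
  by move=> u; apply: continuous_comp; [exact: continuous_cone|exact: cF].
have [M FM] := bounded_on_box K cFu.
exists (K + `|M|) => u; have [uK|uK] := pselect (forall i, `|u 0 i| <= K).
  rewrite box_in; last by move=> i; rewrite ler_wpDr.
  by rewrite (le_trans (FM u uK))// (le_trans (ler_norm M))// lerDr /K normr_ge0.
suff q0 : future t0 (p.1 + u, p.2 + a * enorm u).
  by rewrite (F0 _ q0) normr0 /box; apply: mulr_ge0 => //; apply: addr_ge0; exact: normr_ge0.
have [i ui] : exists i, K < `|u 0 i|.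
  apply: contrapT => h; apply: uK => i; rewrite leNgt; apply/negP => ui.
  by apply: h; exists i.
rewrite /future /mkset /= -ltrBlDl -ltr_pdivrMl// mulrC.
apply: lt_le_trans (coord_le_enorm u i).
by apply: le_lt_trans ui; exact: ler_norm.
Qed.

Lemma nice_cone F (p : V) (a t0 : R) : 0 < a -> continuous F ->
  (forall q, future t0 q -> F q = 0) ->
  nice (fun u => F (p.1 + u, p.2 + a * enorm u)).
Proof.
move=> a0 cF F0; split; last exact: cone_box F0.
apply: measurable_rowt_continuous => u.
by apply: continuous_comp; [exact: continuous_cone|exact: cF].
Qed.

Lemma is_derive_time F x t (s : R) : smooth F ->
  is_derive s 1 (fun s => F (x, t + s)) (partial None F (x, t + s)).
Proof.
move=> sF.
have E s' : (x, t) + s' *: (axis None : V) = (x, t + s').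
  by congr (_, _); rewrite /= ?scaler0 ?addr0// [_ *: 1]mulr1.
have := (is_derive_line F (x, t) (axis None) s _).1 (is_derive_axis None _ sF).
by rewrite E; under eq_fun do rewrite E.
Qed.

Lemma Rintegral_oo_cc (f : R -> R) (a b : R) : continuous f ->
  \int[lambda]_(x in `]a, b[) f x = \int[lambda]_(x in `[a, b]) f x.
Proof.
move=> cf; have fi := continuous_integrable_itv a b cf.
rewrite Rintegral_itv_obnd_cbnd; last first.
  by apply: integrableS fi => //; exact: subset_itv_oo_cc.
rewrite Rintegral_itv_bndo_bndc//.
by apply: integrableS fi => //; exact: subset_itv_co_cc.
Qed.

Lemma sqnZ (a : R) (u : E) : sqn (a *: u) = a ^+ 2 * sqn u.
Proof. by rewrite /sqn mulr_sumr; apply: eq_bigr => i _; rewrite mxE exprMn. Qed.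

(* Integrating in [r] first the function [Phi] below gives, by the fundamental
   theorem of calculus, the values of [F] on the cone; integrating in [u] first
   gives the ball means. *)
Lemma conical_radon_ball_mean phi (c : R) F (p : V) (t0 T : R) :
  0 < c -> cot phi = c^-1 -> smooth F ->
  (forall q, future t0 q -> F q = 0) -> 0 <= T -> t0 < p.2 + T -> (0 < m)%N ->
  conical_radon phi F p =
  - (c ^+ m * \int[lambda]_(r in `[0, T])
      (r ^+ m * ball_mean c p 0 0 (partial None F) r r)).
Proof.
move=> c0 cotE sF F0 T0 t0T m0.
have sF' : smooth (partial None F) by exact: smooth_partial.
pose F' := partial None F.
(* Indicator of the solid cone [|u| < c r], [0 < r < T], written with signs of continuous functions
   so that [measurable_lt0] applies. *)
pose b (r : R) (u : E) : R := (- r < 0)%R%:R * (r - T < 0)%R%:R *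
  (sqn u - (c * r) ^+ 2 < 0)%R%:R.
pose Phi (r : R) (u : E) := b r u * F' (p.1 + u, p.2 + r).
(* [r] becomes the head coordinate in dimension [m + 1], ready for both orders of integration. *)
pose f (w : 'rV[R]_m.+1) := Phi (w 0 ord0) (row_tail w).
have b01 r u : 0 <= b r u <= 1.
  by rewrite !mulr_ge0//= !mulr_ile1 ?mulr_ge0// lern1 leq_b1.
have b0 r u : b r u != 0 -> [/\ 0 < r, r < T & sqn u < (c * r) ^+ 2].
  rewrite /b; case: (ltP (- r) 0); last by rewrite !mul0r eqxx.
  case: (ltP (r - T) 0); last by rewrite mulr0 mul0r eqxx.
  case: (ltP (sqn u - _) 0); last by rewrite !mulr0 eqxx.
  by rewrite !subr_lt0 oppr_lt0.
have b1 r u : 0 < r -> r < T -> sqn u < (c * r) ^+ 2 -> b r u = 1.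
  by move=> r0 rT ur; rewrite /b oppr_lt0 r0 !subr_lt0 rT ur !mulr1.
have cF' : continuous F' by exact: smooth_continuous.
have cw : continuous (fun w : 'rV[R]_m.+1 => w 0 ord0) by exact: continuous_coord.
have cG : continuous (fun w : 'rV[R]_m.+1 => (p.1 + row_tail w, p.2 + w 0 ord0)).
  apply: continuous_pair.
    by apply: cont_addv; [exact: cst_continuous|exact: continuous_row_tail].
  by apply: contD => //; exact: cont_cst.
have cFG : continuous (fun w : 'rV[R]_m.+1 => F' (p.1 + row_tail w, p.2 + w 0 ord0)).
  by move=> w; apply: continuous_comp; [exact: cG|exact: cF'].
have nf : nice f.
  split.
    have c1 : continuous (fun w : 'rV[R]_m.+1 => - w 0 ord0).
      by apply: (cont_comp cw); exact: opp_continuous.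
    have c2 : continuous (fun w : 'rV[R]_m.+1 => w 0 ord0 - T).
      by apply: contB => //; exact: cont_cst.
    have c3 : continuous (fun w : 'rV[R]_m.+1 => sqn (row_tail w) - (c * w 0 ord0) ^+ 2).
      apply: contB.
        move=> w; apply: continuous_comp; first exact: continuous_row_tail.
        exact: continuous_sqn.
      have cc : continuous (fun w : 'rV[R]_m.+1 => c * w 0 ord0).
        by apply: contM => //; exact: cont_cst.
      exact: (cont_comp cc (@continuous_exprn R 2)).
    exact: (measurable_funM (measurable_funM (measurable_funM (measurable_lt0 c1)
      (measurable_lt0 c2)) (measurable_lt0 c3)) (measurable_rowt_continuous cFG)).
  have [M FM] := bounded_on_box (T + c * T) cFG.
  have cT0 : 0 <= c * T by rewrite mulr_ge0// ltW.
  have TT : 0 <= T + c * T by rewrite addr_ge0.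
  exists (`|M| + (T + c * T)) => w; rewrite /f /Phi.
  have [->|/b0 [w0 wT wr]] := eqVneq (b (w 0 ord0) (row_tail w)) 0.
    by rewrite mul0r normr0 mulr_ge0// addr_ge0.
  have wb i : `|w 0 i| <= T + c * T.
    have [j ->|->] := unliftP ord0 i; last first.
      by rewrite gtr0_norm// ler_wpDr// ltW.
    have wj := le_lt_trans (sqn_coord (row_tail w) j) wr.
    rewrite mxE in wj; rewrite ler_wpDl//.
    rewrite -(@ler_pXn2r _ 2) ?nnegrE// -normrX ger0_norm ?sqr_ge0//.
    rewrite (le_trans (ltW wj))// ler_pXn2r ?nnegrE// ?mulr_ge0 ?ltW//.
    by rewrite ltr_pM2l.
  rewrite box_in; last by move=> i; rewrite (le_trans (wb i))// lerDr.
  rewrite normrM; have /andP[h0 h1] := b01 (w 0 ord0) (row_tail w).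
  rewrite (ger0_norm h0) (le_trans (ler_wpM2r (normr_ge0 _) h1))// mul1r.
  by rewrite (le_trans (FM w wb))// (le_trans (ler_norm M))// lerDl.
have fE r u : f (row_cons r u) = Phi r u by rewrite /f row_tail_cons row_cons_head.
(* For fixed [u] the cone condition leaves [r] between [cot phi * enorm u] and [T]. The primitive
   [F] vanishes at the upper end, so minus its value on the cone surface remains. *)
have inner u : \int[lambda]_r f (row_cons r u) =
    -1 * F (p.1 + u, p.2 + cot phi * enorm u).
  rewrite mulN1r; set a := cot phi * enorm u.
  have ba r : b r u != 0 -> a < r /\ r < T.
    move=> /b0[r0 rT ur]; split => //; rewrite /a cotE ltr_pdivrMl//.
    rewrite enorm_sqn -(@ltr_pXn2r _ 2) ?nnegrE ?sqrtr_ge0 ?mulr_ge0 ?ltW//.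
    by rewrite sqr_sqrtr// sqn_ge0.
  have a0 : 0 <= a by rewrite /a cotE mulr_ge0 ?sqrtr_ge0// invr_ge0 ltW.
  have ab r : a < r -> r < T -> b r u = 1.
    move=> ar rT; have r0 : 0 < r by exact: le_lt_trans ar.
    apply: b1 => //; move: ar; rewrite /a cotE ltr_pdivrMl// enorm_sqn.
    rewrite -(@ltr_pXn2r _ 2) ?nnegrE ?sqrtr_ge0 ?mulr_ge0 ?ltW//.
    by rewrite sqr_sqrtr// sqn_ge0.
  rewrite (@Rintegral_setT_outside _ _ `]a, T[); last first.
    move=> r /= rD; rewrite fE /Phi; have [->|/ba[ar rT]] := eqVneq (b r u) 0.
      by rewrite mul0r.
    by exfalso; apply: rD; rewrite in_itv /= ar rT.
  rewrite (@eq_Rintegral _ _ _ lambda _ (fun r => F' (p.1 + u, p.2 + r))); last first.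
    move=> r; rewrite inE /= in_itv /= => /andP[ar rT].
    by rewrite fE /Phi ab// mul1r.
  have [aT|Ta] := leP a T; last first.
    rewrite set_itv_ge ?Rintegral_set0; last by rewrite -leNgt bnd_simp ltW.
    rewrite F0 ?oppr0//; apply: (lt_trans t0T); by rewrite ltrD2l.
  have cu : continuous (fun r : R => F' (p.1 + u, p.2 + r)).
    have cp : continuous (fun r : R => (p.1 + u, p.2 + r)).
      apply: continuous_pair; first exact: cst_continuous.
      by apply: contD; [exact: cont_cst|move=> r; exact: cvg_id].
    by move=> r; apply: continuous_comp; [exact: cp|exact: cF'].
  rewrite Rintegral_oo_cc//.
  have dF (r : R) : is_derive r 1 (fun r => F (p.1 + u, p.2 + r)) (F' (p.1 + u, p.2 + r)).
    exact: is_derive_time.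
  by rewrite (Rintegral_FTC2 aT dF cu) [X in X - _]F0 ?sub0r.
have E1 : Int f = - conical_radon phi F p.
  rewrite Int_cons_swap//.
  have cot0 : 0 < cot phi by rewrite cotE invr_gt0.
  rewrite -mulN1r; apply: etrans (IntZ (-1) (nice_cone p cot0 (smooth_continuous sF) F0)).
  by congr Int; apply/funext => u; exact: inner.
have cB : continuous (fun r : R => ball_mean c p 0 0 F' r r).
  apply: (@continuous_diag _ (fun a b => ball_mean c p a b F')).
  by move=> *; exact: is_derive_ball_mean.
have cI : continuous (fun r : R => r ^+ m * ball_mean c p 0 0 F' r r).
  by apply: contM => //; exact: continuous_exprn.
have E2 : Int f = c ^+ m * \int[lambda]_(r in `[0, T])
      (r ^+ m * ball_mean c p 0 0 F' r r).
  rewrite Int_cons// -RintegralZl//; last exact: continuous_integrable_itv.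
  rewrite -Rintegral_oo_cc; last by apply: contM => //; exact: cont_cst.
  rewrite (@Rintegral_setT_outside _ _ `]0, T[); last first.
    move=> r /= rD; rewrite -[RHS](@Int0 R m); congr Int; apply/funext => u.
    rewrite fE /Phi; have [->|/b0[r0 rT _]] := eqVneq (b r u) 0.
      by rewrite mul0r.
    by exfalso; apply: rD; rewrite in_itv /= r0 rT.
  apply: eq_Rintegral => r; rewrite inE /= in_itv /= => /andP[r0 rT].
  have cr0 : 0 < c * r by rewrite mulr_gt0.
  (* The substitution [u = c r z] turns the slice into the unit ball, with Jacobian [(c r) ^+ m]. *)
  rewrite (Int_scale cr0 (nice_cons r nf)) exprMn -mulrA; congr (_ * (_ * _)).
  rewrite /ball_mean; congr Int; apply/funext => z.
  rewrite fE /Phi expr0 mul1r; congr (_ * _).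
  rewrite /b /bl oppr_lt0 r0 subr_lt0 rT !mul1r sqnZ subr_lt0.
  by rewrite -[X in _ < X]mulr1 ltr_pM2l// exprn_gt0.
by rewrite -E2 E1 opprK.
Qed.

End ConeIntegral.

(** * Test functions and commutation of the transform with derivatives *)

Section TestFunctions.
Context {R : realType} {m : nat}.
Local Notation E := 'rV[R]_m.
Local Notation V := (E * R)%type.
Implicit Types (f : V -> R) (p : V) (M : R).

(** Compact support is handled as vanishing on this set: it is open, so the vanishing passes to all
    derivatives. *)
Definition far M : set V := [set p | M < `|p|].

Definition test_function f := smooth f /\ exists M, forall p, far M p -> f p = 0.

Lemma open_far M : open (far M).
Proof.
exact: (open_comp (fun p _ => @norm_continuous R V p) (open_gt (y := M))).
Qed.

Lemma far_acoord M p i : M < `|acoord p i| -> far M p.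
Proof. by move=> Mi; apply: lt_le_trans Mi (acoord_norm_le p i). Qed.

Lemma farP M p : 0 <= M -> far M p -> exists i, M < `|acoord p i|.
Proof.
move=> M0 Mp; apply: contrapT => h.
have : `|p| < `|p|; last by rewrite ltxx.
apply: norm_acoord_lt => [|i]; first exact: le_lt_trans Mp.
apply: le_lt_trans Mp; rewrite leNgt; apply/negP => Mi; apply: h; by exists i.
Qed.

Lemma future_far M : future M `<=` far M.
Proof.
move=> p Mp; apply: (@far_acoord M p None) => /=.
by apply: lt_le_trans Mp (ler_norm _).
Qed.

Lemma compact_supp_far f : compact (supp f) -> exists M, forall p, far M p -> f p = 0.
Proof.
move=> /compact_bounded[M [_ fM]]; exists (M + 1) => p Mp.
apply: contrapT => /eqP fp.
have : `|p| <= M + 1 by apply: (fM (M + 1)); [rewrite ltrDl|exact: subset_closure].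
by rewrite leNgt => /negP; apply.
Qed.

Lemma far_compact_supp f M : (forall p, far M p -> f p = 0) -> compact (supp f).
Proof.
move=> f0; pose A : set E := [set v | forall i, `[-M, M]%classic (v ord0 i)].
have cA : compact A.
  by apply: (@rV_compact R m (fun=> `[-M, M]%classic)) => i; exact: segment_compact.
have cB : compact (A `*` `[-M, M]%classic).
  by apply: compact_setX => //; exact: segment_compact.
apply: (subclosed_compact _ cB); first exact: closed_closure.
have clB : closed (A `*` `[-M, M]%classic).
  by apply: compact_closed cB; exact: norm_hausdorff.
rewrite ((closure_id _).1 clB); apply: closureS => p /= fp.
have pM i : `|acoord p i| <= M.
  by rewrite leNgt; apply/negP => /far_acoord /f0 p0; rewrite p0 eqxx in fp.
split=> [i|] /=; rewrite in_itv /= -ler_norml; [exact: (pM (Some i))|exact: (pM None)].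
Qed.

Lemma test_partial i f : test_function f -> test_function (partial i f).
Proof.
move=> [sf [M f0]]; split; first exact: smooth_partial.
by exists M; apply: partial_open0 => //; exact: open_far.
Qed.

Lemma test_iter_dalembertian phi n f :
  test_function f -> test_function (iter n (dalembertian phi) f).
Proof.
move=> [sf [M f0]]; split; first exact: smooth_iter_dalembertian.
by exists M; apply: iter_dalembertian_open0 => //; exact: open_far.
Qed.

Lemma test_bounded f : test_function f -> exists2 K, 0 <= K & forall p, `|f p| <= K.
Proof.
move=> [sf [M f0]]; have [K fK] := bounded_on_space_time_box M (smooth_continuous sf).
exists `|K| => // p; have [Mp|pM] := ltP M `|p|.
  by rewrite (f0 p Mp) normr0.
apply: le_trans (ler_norm K); apply: fK => i; exact: le_trans (acoord_norm_le p i) pM.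
Qed.

Lemma conical_radonE phi f p :
  conical_radon phi f p = Int (fun u => f (p.1 + u, p.2 + cot phi * enorm u)).
Proof. by []. Qed.

Section conical.
Variables (phi : R) (phi0 : 0 < cot phi).

Lemma test_nice_cone f p : test_function f ->
  nice (fun u => f (p.1 + u, p.2 + cot phi * enorm u)).
Proof.
move=> [sf [M f0]]; apply: (nice_cone p phi0 (smooth_continuous sf) (t0 := M)).
by move=> q /future_far; exact: f0.
Qed.

Lemma is_derive_conical_radon f i p : test_function f ->
  is_derive p (axis i) (conical_radon phi f) (conical_radon phi (partial i f) p).
Proof.
move=> tf; have [sf _] := tf; have tf' := test_partial i tf.
have [K K0 fK] := test_bounded tf'; have [_ [M f0]] := tf'.
pose cone (u : E) : V := (p.1 + u, p.2 + cot phi * enorm u).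
(* For [|s| < 1] the moving vertex has coordinates at most [|p| + |axis i|], so once a coordinate of
   [u] exceeds [N] the point of the cone is outside the support for every such [s]. *)
pose N : R := `|M| + (`|p| + `|axis i : V|).
have N0 : 0 <= N by rewrite !addr_ge0.
have coneE (s : R) u : ((p + s *: axis i).1 + u,
    (p + s *: axis i).2 + cot phi * enorm u) = cone u + s *: axis i :> V.
  by rewrite /cone; case: (s *: axis i) => a b; congr (_, _); rewrite /= addrAC.
have df : is_derive (0 : R) 1
    (fun s => Int (fun u => f (cone u + s *: axis i)))
    (Int (fun u => partial i f (cone u + 0 *: axis i))).
  apply: (@is_derive_Int R m (fun s u => f (cone u + s *: axis i))
    (fun s u => partial i f (cone u + s *: axis i)) 0 1 (K + N)) => //.
  - move=> s u _; exact: ((is_derive_line f (cone u) (axis i) s _).1 (is_derive_axis i _ sf)).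
  - move=> s u; rewrite subr0 => s1; have [uN|uN] := pselect (forall j, `|u 0 j| <= N).
      rewrite box_in; first by rewrite (le_trans (fK _))// lerDl.
      by move=> j; rewrite (le_trans (uN j))// lerDr.
    have [j uj] : exists j, N < `|u 0 j|.
      by apply: contrapT => h; apply: uN => j; rewrite leNgt; apply/negP => uj; apply: h; exists j.
    rewrite f0; first by rewrite normr0 /box mulr_ge0// addr_ge0.
    apply: (@far_acoord M _ (Some j)); rewrite -coneE /= mxE.
    have pj : `|(p + s *: axis i).1 0 j| <= `|p| + `|axis i : V|.
      apply: le_trans (acoord_norm_le (p + s *: axis i) (Some j)) _.
      rewrite (le_trans (ler_normD _ _))// lerD2l normrZ.
      by rewrite ler_piMl// ltW.
    rewrite addrC; apply: lt_le_trans (lerB_normD _ _).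
    rewrite ltrBrDr (le_lt_trans _ uj)// lerD//; exact: ler_norm.
  - move=> s _; have := test_nice_cone (p + s *: axis i) tf.
    by congr nice; apply/funext => u; rewrite coneE.
have E1 : (fun s : R => Int (fun u => f (cone u + s *: axis i))) =
    (fun s => conical_radon phi f (p + s *: axis i)).
  by apply/funext => s; rewrite conical_radonE; congr Int; apply/funext => u; rewrite -coneE.
have E2 : Int (fun u => partial i f (cone u + 0 *: axis i)) =
    conical_radon phi (partial i f) p.
  by rewrite conical_radonE; congr Int; apply/funext => u; rewrite scale0r addr0.
rewrite E1 E2 in df.
have := (is_derive_line (conical_radon phi f) p (axis i) 0 _).2 df.
by rewrite scale0r addr0.
Qed.

Lemma partial_conical_radon f i : test_function f ->
  partial i (conical_radon phi f) = conical_radon phi (partial i f).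
Proof.
move=> tf; apply/funext => p; rewrite partialE.
by have [_ ->] := is_derive_conical_radon i p tf.
Qed.

(** A convolution commutes with constant-coefficient operators; the induction works because the
    iterates remain test functions. *)
Lemma iter_dalembertian_conical_radon n f : test_function f ->
  iter n (dalembertian phi) (conical_radon phi f) =
  conical_radon phi (iter n (dalembertian phi) f).
Proof.
move=> tf; elim: n => [//|n IH]; rewrite !iterS IH.
have := test_iter_dalembertian phi n tf; set h := iter n _ f => th.
have pp i : partial i (partial i (conical_radon phi h)) =
    conical_radon phi (partial i (partial i h)).
  have E1 := partial_conical_radon i th.
  exact: (etrans (congr1 (partial i) E1) (partial_conical_radon i (test_partial i th))).
have nc i p := test_nice_cone p (test_partial i (test_partial i th)).
rewrite !dalembertianE; apply/funext => p /=.
rewrite (congr1 (fun F => F p) (pp None)).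
under eq_bigr => j _ do rewrite (congr1 (fun F => F p) (pp (Some j))).
pose L (j : 'I_m) (u : E) : R := partial (Some j) (partial (Some j) h)
  (p.1 + u, p.2 + cot phi * enorm u).
have nL j : nice (L j) by exact: nc.
have nS := nice_sum (index_enum 'I_m) nL.
have E1 := IntD (nc None p) (niceZ (- tan phi ^+ 2) nS).
have E2 := IntZ (- tan phi ^+ 2) nS.
rewrite E2 (Int_sum _ nL) in E1.
exact: (esym E1).
Qed.

End conical.

End TestFunctions.

(** * The time primitive *)

Section TimePrimitive.
Context {R : realType} {m : nat}.
Local Notation lambda := (@lebesgue_measure R).
Local Notation E := 'rV[R]_m.
Local Notation V := (E * R)%type.
Implicit Types (f h : V -> R) (p : V) (M : R).

Definition time_shift (s : R) p : V := (p.1, p.2 + s).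

Definition time_integral h p : R :=
  \int[lambda]_(s in `[0, +oo[) h (time_shift s p).

Lemma time_shiftD s p (v : V) : time_shift s (p + v) = time_shift s p + v.
Proof. by rewrite /time_shift; case: v => a b; congr (_, _); rewrite /= addrAC. Qed.

Lemma continuous_time_shift p : continuous (fun s => time_shift s p).
Proof.
apply: continuous_pair; first exact: cst_continuous.
by apply: contD; [exact: cont_cst|move=> s; exact: cvg_id].
Qed.

Lemma far_time_shift M p s : M + `|p| < `|s| -> far M (time_shift s p).
Proof.
move=> Ms; apply: (@far_acoord _ _ M _ None) => /=.
rewrite addrC; apply: lt_le_trans (lerB_normD _ _); rewrite ltrBrDr.
by apply: le_lt_trans Ms; rewrite lerD2l; exact: (acoord_norm_le p None).
Qed.

Definition window (K L s : R) : R := K * \1_(`[- L, L]%classic) s.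

Lemma integrable_window D (K L : R) : measurable D ->
  lambda.-integrable D (EFin \o window K L).
Proof.
move=> mD; apply: (integrableS measurableT mD) => //.
have -> : EFin \o window K L = (fun u => K%:E * (\1_(`[(- L)%R, L]%classic) u)%:E)%E.
  by apply/funext => u; rewrite /= EFinM.
apply: integrableZl => //; exact: integrable_indic_itv.
Qed.

Lemma window_le (x K L s : R) : `|x| <= K -> (L < `|s| -> x = 0) ->
  `|x| <= window K L s.
Proof.
move=> xK x0; rewrite /window indicE; have [sL|sL] := leP `|s| L.
  by rewrite mem_set ?mulr1//= in_itv /= -ler_norml.
rewrite memNset ?mulr0; last by rewrite /= in_itv /= -ler_norml leNgt sL.
by rewrite x0 ?normr0.
Qed.

Lemma continuous_time_line h p : test_function h ->
  continuous (fun s => h (time_shift s p)).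
Proof.
move=> [sh _] s; apply: continuous_comp; first exact: continuous_time_shift.
exact: smooth_continuous.
Qed.

Lemma test_integrable D h p : measurable D -> test_function h ->
  lambda.-integrable D (EFin \o (fun s => h (time_shift s p))).
Proof.
move=> mD th; apply: (integrableS measurableT mD) => //.
 have [K K0 hK] := test_bounded th; have [sh [M h0]] := th.
apply: le_integrable (integrable_window K (M + `|p|) measurableT) => //.
  apply/measurable_EFinP; apply: continuous_measurable_fun.
  exact: continuous_time_line.
move=> s _ /=; rewrite lee_fin; apply: le_trans (ler_norm _).
by apply: window_le => // /far_time_shift; exact: h0.
Qed.

Lemma is_derive_time_integral h i p : test_function h ->
  is_derive p (axis i) (time_integral h) (time_integral (partial i h) p).
Proof.
move=> th; have [sh _] := th; have th' := test_partial i th.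
have [K K0 hK] := test_bounded th'; have [_ [M h0]] := th'.
pose N : R := `|p| + `|axis i : V|.
have shE s (r : R) : h (time_shift s p + r *: axis i) = h (time_shift s (p + r *: axis i)).
  by rewrite time_shiftD.
have df : is_derive (0 : R) 1
    (fun r => \int[lambda]_(s in `[0, +oo[) h (time_shift s p + r *: axis i))
    (\int[lambda]_(s in `[0, +oo[) partial i h (time_shift s p + 0 *: axis i)).
  have H := @is_derive_Rintegral R _ _ lambda `[0, +oo[
    (fun r s => h (time_shift s p + r *: axis i))
    (fun r s => partial i h (time_shift s p + r *: axis i))
    (window K (M + N)) 0 1 (measurable_itv _) ltr01.
  have H1 (x y : R) : `|x - 0| < 1 -> is_derive x 1 
      (fun r => h (time_shift y p + r *: axis i)) (partial i h (time_shift y p + x *: axis i)).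
    move=> _; exact: ((is_derive_line h (time_shift y p) (axis i) x _).1 (is_derive_axis i _ sh)).
  apply: (H H1) => [x s||x]; last 1 first.
  - move=> _; have := test_integrable (p + x *: axis i) (measurable_itv `[0, +oo[) th.
    by congr integrable; apply/funext => s; exact: congr1 (esym (shE s x)).
  - rewrite subr0 => x1; apply: window_le => // sL.
    rewrite h0// -time_shiftD; apply: far_time_shift; apply: le_lt_trans sL.
    by rewrite lerD2l (le_trans (ler_normD _ _))// lerD2l normrZ ler_piMl// ltW.
  - exact: integrable_window.
have E1 : (fun r : R => \int[lambda]_(s in `[0, +oo[) h (time_shift s p + r *: axis i)) =
    (fun r => time_integral h (p + r *: axis i)).
  by apply/funext => r; apply: eq_Rintegral => s _; exact: shE.
have E2 : \int[lambda]_(s in `[0, +oo[) partial i h (time_shift s p + 0 *: axis i) =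
    time_integral (partial i h) p.
  by apply: eq_Rintegral => s _; rewrite scale0r addr0.
rewrite E1 E2 in df.
have := (is_derive_line (time_integral h) p (axis i) 0 _).2 df.
by rewrite scale0r addr0.
Qed.

(** The constant is the sum of bounds for the partial derivatives; it turns continuity of
    [time_integral] into a direct estimate. *)
Lemma test_lipschitz h : test_function h ->
  exists2 K, 0 <= K & forall p v, `|h (p + v) - h p| <= K * `|v|.
Proof.
move=> th; have [sh _] := th.
have : forall i, exists K, forall p, `|partial i h p| <= K.
  by move=> i; have [K _ hK] := test_bounded (test_partial i th); exists K.
move=> /choice[K hK].
have K0 i : 0 <= K i by apply: le_trans (hK i 0).
exists (\sum_i K i); first exact: sumr_ge0.
move=> p v; have [c _ ->] := @is_derive_increment _ _ h p v
   (fun s => dirD v h (p + s *: v)) (fun s => is_derive_dirD _ _ sh).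
rewrite /dirD (le_trans (ler_norm_sum _ _ _))// mulr_suml ler_sum// => i _.
by rewrite normrM mulrC ler_pM// acoord_norm_le.
Qed.

Lemma continuous_time_integral h : test_function h -> continuous (time_integral h).
Proof.
move=> th p; have [K K0 hK] := test_lipschitz th; have [_ [M h0]] := th.
(* [W] is the length of a time window outside which both integrands vanish; the summand 1 makes the
   window valid for all [|v| < 1] at once. *)
pose W := \int[lambda]_(s in `[0, +oo[) window 1 (M + (`|p| + 1)) s.
have W0 : 0 <= W.
  apply: Rintegral_ge0 => s _; rewrite mulr_ge0//.
have lip v : `|v| < 1 -> `|time_integral h (p + v) - time_integral h p| <= K * `|v| * W.
  move=> v1; rewrite -RintegralB//; [|exact: test_integrable|exact: test_integrable].
  have iB : lambda.-integrable `[0, +oo[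
     (EFin \o (fun s => h (time_shift s (p + v)) - h (time_shift s p))).
    by apply: (integrableB _ (test_integrable (p + v) _ th) (test_integrable p _ th)).
  rewrite (le_trans (le_normr_Rintegral _ iB))// /W -RintegralZl//; last exact: integrable_window.
  apply: le_Rintegral => //.
  - by have := integrable_norm iB.
  - have := integrable_window (K * `|v|) (M + (`|p| + 1)) (measurable_itv `[0, +oo[).
    by congr integrable; apply/funext => s; rewrite /= /window mul1r.
  - move=> s _; rewrite /window mul1r; apply: window_le => //; first by rewrite time_shiftD.
    move=> sL; rewrite !h0 ?subrr//; apply: far_time_shift; apply: le_lt_trans sL.
      by rewrite lerD2l// lerDl.
    by rewrite lerD2l// (le_trans (ler_normD _ _))// lerD2l ltW.
have KW : 0 < K * W + 1 by rewrite ltr_wpDl// mulr_ge0.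
have near_p (d : R) : 0 < d -> \forall q \near p, `|p - q| < d.
  by move=> d0; exact: ((@cvgrPdist_lt _ _ _ (nbhs p) _ id p).1 (@cvg_id _ _) d d0).
apply/cvgrPdist_lt => e e0; near=> q.
have qp1 : `|q - p| < 1 by rewrite distrC; near: q; exact: near_p.
have qpe : `|q - p| < e / (K * W + 1).
  by rewrite distrC; near: q; apply: near_p; rewrite divr_gt0.
have := lip (q - p) qp1; rewrite subrKC distrC => /le_lt_trans; apply.
rewrite mulrAC; apply: (@le_lt_trans _ _ ((K * W + 1) * `|q - p|)).
  by rewrite ler_wpM2r// lerDl.
by rewrite -ltr_pdivlMl// mulrC.
Unshelve. all: by end_near. Qed.

Lemma foldr_partial_time_integral h s : test_function h ->
  foldr partial (time_integral h) s = time_integral (foldr partial h s).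
Proof.
elim/last_ind: s h => [//|s i IH] h th.
have E1 : partial i (time_integral h) = time_integral (partial i h).
  by apply/funext => p; rewrite partialE; have [_ ->] := is_derive_time_integral i p th.
rewrite 2!foldr_rcons.
exact: (etrans (congr1 (fun F => foldr partial F s) E1) (IH _ (test_partial i th))).
Qed.

Lemma test_foldr_partial h s : test_function h -> test_function (foldr partial h s).
Proof. by move=> th; elim: s => [//|i s IH] /=; exact: test_partial. Qed.

Lemma smooth_time_integral h : test_function h -> smooth (time_integral h).
Proof.
move=> th; apply/smoothP => s; rewrite (foldr_partial_time_integral s th).
have ts := test_foldr_partial s th; split; first exact: continuous_time_integral.
by move=> i p; apply: is_derive_derivable; exact: is_derive_time_integral.
Qed.

End TimePrimitive.

(** * Range of the conical Radon transform *)

Section Range.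
Context {R : realType} {m : nat}.
Local Notation lambda := (@lebesgue_measure R).
Local Notation E := 'rV[R]_m.
Local Notation V := (E * R)%type.
Implicit Types (f g h : V -> R) (p : V) (M : R).

Lemma time_integral_partial h p : test_function h ->
  time_integral (partial None h) p = - h p.
Proof.
move=> th; have [sh [M h0]] := th.
pose L := `|M| + `|p| + 1.
have L0 : 0 <= L by rewrite !addr_ge0.
have hL s : M + `|p| < s -> far M (time_shift s p).
  by move=> Ms; apply: far_time_shift; apply: lt_le_trans Ms (ler_norm _).
have ML : M + `|p| < L by rewrite ltr_pwDr// lerD2r ler_norm.
have sh' := test_partial None th.
rewrite /time_integral (@Rintegral_eq0_outside _ _ `[0, L]); last 2 first.
- by move=> s /=; rewrite !in_itv /= andbT => /andP[].
- move=> s /=; rewrite !in_itv /= andbT => -> /negP; rewrite -ltNge => Ls.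
  apply: (partial_open0 _ sh (@open_far _ _ M) h0).
  by apply: hL; exact: lt_trans Ls.
have dF (s : R) : is_derive s 1 (fun s => h (time_shift s p))
    (partial None h (time_shift s p)) by exact: is_derive_time.
rewrite (Rintegral_FTC2 L0 dF (continuous_time_line sh')).
rewrite h0 ?sub0r; last exact: hL.
by rewrite /time_shift addr0 -surjective_pairing.
Qed.

(** Far away in space and at late times the integrand vanishes identically. At early times the
    half-line covers the whole support in time, so the value is the full time integral, which is
    zero. *)
Lemma test_time_integral h : test_function h ->
  (forall x, \int[lambda]_t h (x, t) = 0) -> test_function (time_integral h).
Proof.
move=> th int0; have [sh [M h0]] := th; have sT := smooth_time_integral th.
split => //; exists `|M|.
have h0' i p : `|M| < `|acoord p i| -> h p = 0.
  by move=> Mp; apply: h0; apply: far_acoord (le_lt_trans (ler_norm M) Mp).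
have late (p : V) : `|M| < p.2 -> time_integral h p = 0.
  move=> Mp; apply: Rintegral_fun0 => s /=; rewrite in_itv /= andbT => s0.
  apply: (h0' None) => /=; apply: lt_le_trans (ler_norm _).
  by rewrite ltr_wpDr.
move=> p /(farP (normr_ge0 M))[[j|] /= Mp].
  by apply: Rintegral_fun0 => s _; exact: (h0' (Some j)).
have [p2|p2] := leP 0 p.2; first by apply: late; rewrite -(ger0_norm p2).
have pM : p.2 < - `|M| by rewrite ltrNr -ltr0_norm.
pose L := `|M| + 1.
have pL : p.2 <= L by rewrite (le_trans (ltW p2))// addr_ge0.
(* The early value is recovered from the derivative [- h] on [[p.2, L]], which contains the support
   in time, and from the vanishing at [L]. *)
have dT (s : R) : is_derive s 1 (fun s => time_integral h (p.1, 0 + s)) (- h (p.1, 0 + s)).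
  rewrite -time_integral_partial//.
  have [_ <-] := is_derive_time_integral None (p.1, 0 + s) th.
  rewrite -partialE; exact: is_derive_time.
have cT : continuous (fun s => - h (p.1, 0 + s)).
  apply: (cont_comp (continuous_time_line (p := (p.1, 0)) th)).
  exact: opp_continuous.
have := Rintegral_FTC2 pL dT cT.
rewrite late; last by rewrite /= add0r ltrDl.
rewrite sub0r add0r -surjective_pairing.
rewrite -Rintegral_setT_outside; last first.
  move=> s /= sD; rewrite (h0' None) ?oppr0//= add0r.
  rewrite ltNge; apply/negP => sM; apply: sD; rewrite in_itv /=.
  move: sM; rewrite ler_norml => /andP[s1 s2].
  by rewrite (le_trans (ltW pM) s1) (le_trans s2)// lerDl.
rewrite (_ : (fun s => _) = (fun s => -1 * h (time_shift s (p.1, 0)))); last first.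
  by apply/funext => s; rewrite mulN1r.
have i0 : lambda.-integrable setT (EFin \o (fun s => h (time_shift s (p.1, 0)))).
  exact: test_integrable.
rewrite (RintegralZl (-1) measurableT i0).
rewrite (_ : (fun s => _) = (fun s => h (p.1, s))); last first.
  by apply/funext => s; rewrite /time_shift add0r.
by rewrite int0 mulr0 => /esym/eqP; rewrite oppr_eq0 => /eqP.
Qed.

Lemma sqn_box (d : R) (z : E) : 0 <= d -> m%:R * d ^+ 2 < 1 ->
  (forall i, `|z 0 i| <= d) -> sqn z < 1.
Proof.
move=> d0 d1 zd; apply: le_lt_trans d1.
rewrite mulr_natl -[X in _ *+ X]card_ord -sumr_const.
apply: ler_sum => i _; rewrite -(@real_normK _ (z 0 i)) ?num_real//.
by rewrite ler_pXn2r ?nnegrE.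
Qed.

(** Makes the constant [N] invertible. The cube of half-width [d = 1 / (m + 1)] lies in the unit
    ball since [m / (m + 1)^2 < 1], and [d <= 1] gives [box d <= bl]. *)
Lemma Int_bl_gt0 : 0 < Int (@bl R m).
Proof.
pose d : R := m.+1%:R^-1.
have d0 : 0 < d by rewrite invr_gt0.
have d1 : d <= 1 by rewrite invf_le1// ler1n.
have nb : nice (@bl R m).
  have -> : (@bl R m) = (fun z => bl z * 1) by apply/funext => z; rewrite mulr1.
  by apply: nice_bl_continuous; exact: cont_cst.
have Ib : 0 < Int (@box R m d).
  pose A := [set u : m.-tuple (measurableTypeR R) |
    forall i, `[- d, d]%classic (tnth u i)].
  have mA : measurable A by exact: measurable_tuple_box.
  have -> : Int (@box R m d) = \int[lebesgue_measure_tuple m]_(u in A) d.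
    rewrite [RHS]Rintegral_mkcond; congr Rintegral; apply/funext => u.
    rewrite /patch /box; case: forallP => [ud|ud].
      rewrite mem_set ?mulr1// => i /=; have := ud i.
      by rewrite mxE ler_norml in_itv.
    rewrite memNset ?mulr0// => Au; apply: ud => i.
    by have := Au i; rewrite mxE ler_norml /= in_itv.
  rewrite Rintegral_cst//.
  rewrite [X in fine X](_ : _ = (\prod_(i < m) (d + d)%:E)%E); last first.
    apply: (etrans (@lebesgue_measure_tuple_box R m (fun=> `[- d, d]%classic)
      (fun=> measurable_itv `[- d, d]))).
    apply: eq_bigr => i _; rewrite lebesgue_measure_itv /= lte_fin.
    by rewrite gtrN// -EFinD opprK.
  by rewrite prodEFin /= mulr_gt0// prodr_gt0// => i _; rewrite addr_gt0.
apply: lt_le_trans Ib _; apply: le_Rintegral => //.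
- exact: integrable_box.
- exact: nice_integrable.
move=> u _; rewrite /box; case: forallP => [zd|_]; last by rewrite mulr0 /bl; case: (_ < _).
rewrite mulr1 /bl (sqn_box (ltW d0))//.
rewrite exprVn ltr_pdivrMr ?exprn_gt0// mul1r -natrX ltr_nat.
by rewrite -mulnn leq_pmulr.
Qed.

Lemma conical_radon_future0 phi f M : 0 < cot phi ->
  (forall p, future M p -> f p = 0) -> forall p, future M p -> conical_radon phi f p = 0.
Proof.
move=> phi0 f0 p Mp; rewrite conical_radonE -[RHS](@Int0 R m); congr Int.
apply/funext => u; apply: f0; apply: lt_le_trans Mp _ => /=.
by rewrite lerDl mulr_ge0 ?sqrtr_ge0// ltW.
Qed.

Lemma supp_half_spaceP f t0 :
  supp f `<=` half_space t0 <-> forall p, future t0 p -> f p = 0.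
Proof.
split=> [f0 p tp|f0].
  apply: contrapT => /eqP fp; have : supp f p by exact: subset_closure.
  by move=> /f0; rewrite /half_space /= leNgt => /negP; apply.
have clH : closed (half_space t0 : set V).
  have -> : half_space t0 = ~` (future t0) :> set V.
    by apply/seteqP; split=> p /=; rewrite /half_space /future /= leNgt => /negP.
  by apply: open_closedC; exact: open_future.
rewrite ((closure_id _).1 clH); apply: closureS => p /= fp.
by rewrite /half_space /= leNgt; apply/negP => /f0 p0; rewrite p0 eqxx in fp.
Qed.

Lemma integral_partial_time f x (a : R) : test_function f ->
  (\int[lambda]_t (- (a * partial None f (x, t)))%:E = 0)%E.
Proof.
move=> tf; have [sf [M f0]] := tf; have tf' := test_partial None tf.
pose G (s : R) : R := partial None f (time_shift s (x, 0)).
have G_int : lambda.-integrable setT (EFin \o G) by exact: test_integrable.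
have G0 : \int[lambda]_s G s = 0.
  apply: (@Rintegral_derive0 _ (fun s => f (x, 0 + s)) _ M).
  - by move=> s; exact: is_derive_time.
  - exact: (continuous_time_line (p := (x, 0)) tf').
  - move=> s Ms; apply: f0; apply: (@far_acoord _ _ M _ None) => /=; by rewrite add0r.
rewrite (_ : (fun t => _) = (fun t => (- a)%:E * (EFin \o G) t)%E); last first.
  by apply/funext => t; rewrite /= /G /time_shift /= add0r -EFinM mulNr.
rewrite integralZl//.
have -> : (\int[lambda]_t (EFin \o G) t = 0)%E.
  by rewrite -[LHS]fineK ?integrable_fin_num// [fine _]G0.
by rewrite mule0.
Qed.

Section dimension.
Variables (phi : R) (q : nat) (phi_in : 0 < phi < pi / 2) (mq : m = q.*2.+1).

Lemma tan_gt0 : 0 < tan phi.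
Proof.
case/andP: phi_in => phi0 phi1; rewrite /tan divr_gt0//.
  by apply: sin_gt0_pi; rewrite phi0/=; have := pi_gt0 R; lra.
by apply: cos_gt0_pihalf; rewrite phi1 andbT; have := pi_gt0 R; lra.
Qed.

Lemma cotE : cot phi = (tan phi)^-1. Proof. by rewrite /tan invf_div. Qed.

Lemma cot_gt0 : 0 < cot phi. Proof. by rewrite cotE invr_gt0 tan_gt0. Qed.

Let m0 : (0 < m)%N. Proof. by rewrite mq. Qed.

Definition cone_cst : R := tan phi ^+ m * (m`!%:R * Int (@bl R m)).

Lemma cone_cst_gt0 : 0 < cone_cst.
Proof. by rewrite /cone_cst !mulr_gt0 ?exprn_gt0 ?tan_gt0 ?Int_bl_gt0 ?ltr0n ?fact_gt0. Qed.

(** Serves both directions: with the iterated d'Alembertian of [f] as [F] and the time derivative of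
    [f] as [g]; and with minus the time primitive of [box^k g] as [F] and [g] itself. *)
Lemma conical_radon_primitive F g t0 : smooth F -> smooth g ->
  (forall p, future t0 p -> F p = 0) -> (forall p, future t0 p -> g p = 0) ->
  partial None F = iter q.+1 (dalembertian phi) g ->
  forall p, conical_radon phi F p = - (cone_cst * g p).
Proof.
move=> sF sg F0 g0 dF p; pose T := `|t0| + `|p.2| + 1.
have T0 : 0 <= T by rewrite !addr_ge0.
have tT : t0 < p.2 + T.
  have := ler_norm t0; have := ler_norm (- p.2); rewrite normrN /T; lra.
rewrite (conical_radon_ball_mean tan_gt0 cotE sF F0 T0 tT m0) dF.
by rewrite (ball_mean_core phi sg mq g0 T0 tT) /cone_cst !mulrA.
Qed.

Lemma iter_dalembertian_range f : test_function f ->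
  iter q.+1 (dalembertian phi) (conical_radon phi f) =
  (fun p => - (cone_cst * partial None f p)).
Proof.
move=> tf; rewrite (iter_dalembertian_conical_radon cot_gt0 q.+1 tf).
have [sf [M f0]] := tf.
have ff p : future M p -> f p = 0 by move=> /future_far; exact: f0.
have oM : open (future M : set V) by exact: open_future.
apply/funext => p; apply: (conical_radon_primitive (t0 := M)).
- exact: smooth_iter_dalembertian.
- exact: smooth_partial.
- exact: iter_dalembertian_open0.
- exact: partial_open0.
- exact: partial_iter_dalembertian.
Qed.

End dimension.

End Range.

Theorem theorem5 (R : realType) (phi : R) (hphi : 0 < phi < pi / 2)
    (k : nat) (hk : (1 <= k)%N)
    (g : 'rV[R]_(2 * k - 1) * R -> R) (hg : smooth g) :
  (exists f : 'rV[R]_(2 * k - 1) * R -> R,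
     [/\ smooth f, compact (supp f) & g = conical_radon phi f])
  <->
  [/\ compact (supp (iter k (dalembertian phi) g)),
      (forall x : 'rV[R]_(2 * k - 1),
         (\int[lebesgue_measure]_t (iter k (dalembertian phi) g (x, t))%:E
          = 0)%E)
    & exists t0 : R, supp g `<=` half_space t0].
Proof.
case: k hk g hg => [//|q] _ g hg.
have mq : (2 * q.+1 - 1)%N = q.*2.+1 by lia.
split=> [[f [sf /compact_supp_far[M f0] gE]]|[ch h_int [t0 /supp_half_spaceP g0]]].
  have tf : test_function f by split => //; exists M.
  rewrite gE (iter_dalembertian_range hphi mq tf); split.
  - apply: (@far_compact_supp _ _ _ M) => p Mp.
    by rewrite (partial_open0 None sf (@open_far _ _ M) f0 Mp) mulr0 oppr0.
  - by move=> x; exact: integral_partial_time.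
  - exists M; apply/supp_half_spaceP; apply: conical_radon_future0.
      exact: (cot_gt0 hphi).
    by move=> p /future_far; exact: f0.
set h := iter _ _ g in ch h_int.
have sh : smooth h by exact: smooth_iter_dalembertian.
have th : test_function h by split => //; exact: compact_supp_far.
have sT : test_function (time_integral h).
  apply: test_time_integral => // x.
  by rewrite /Rintegral h_int.
have [smT [M T0]] := sT.
pose N := cone_cst phi (m := (2 * q.+1 - 1)%N).
have N0 : N != 0 by rewrite gt_eqF//; exact: (cone_cst_gt0 hphi).
exists (fun p => N^-1 * time_integral h p); split.
- exact: smoothZ.
- by apply: (@far_compact_supp _ _ _ M) => p /T0 ->; rewrite mulr0.
have nT p := test_nice_cone (cot_gt0 hphi) p sT.
(* The primitive integrates over the future and so has derivative [- h]; the factor [-1] restores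
   the sign that [conical_radon_primitive] expects. *)
have E1 : partial None (fun p => -1 * time_integral h p) = h.
  rewrite (partialZ (-1) None smT); apply/funext => p.
  have [_] := is_derive_time_integral None p th; rewrite -partialE => ->.
  by rewrite time_integral_partial// mulN1r opprK.
have CZ (a : R) p : conical_radon phi (fun p => a * time_integral h p) p =
    a * conical_radon phi (time_integral h) p.
  exact: (IntZ a (nT p)).
(* A common time after which both the primitive and [g] vanish. *)
pose t1 := Num.max M t0.
have F0 p : future t1 p -> -1 * time_integral h p = 0.
  move=> tp; rewrite T0 ?mulr0//; apply: future_far; apply: le_lt_trans tp.
  by rewrite le_max lexx.
have G0 p : future t1 p -> g p = 0.
  by move=> tp; apply: g0; apply: le_lt_trans tp; rewrite le_max lexx orbT.
apply/funext => p; rewrite CZ.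
have := conical_radon_primitive hphi mq (smoothZ (-1) smT) hg F0 G0 E1 p.
by rewrite CZ mulN1r => /oppr_inj ->; rewrite mulKf.
Qed.
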